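(* For every integral curve $\gamma=[v_1\dots v_n]\subset\mathbb{R}^3$ and every $\varepsilon>0$, there is an integral curve $\gamma'=[v_1'\dots v_n']\subset\mathbb{R}^3$ of the same length $n$ such that $|\gamma,\gamma'|_F<\varepsilon$ and $\gamma'$ can be domed.
   Context: An integral curve of length $n$ is a closed polygon $\gamma=[v_1\dots v_n]$ in $\mathbb{R}^3$ (indices mod $n$) with $|v_iv_{i+1}|=1$ for all $i$ (a side of integer length $k$ is regarded as $k$ consecutive collinear unit edges). For two integral curves $\gamma=[v_1\dots v_n]$, $\gamma'=[v_1'\dots v_n']$ of the same length, the Fréchet distance is $|\gamma,\gamma'|_F=\max_{1\le i\le n}|v_iv_i'|$. A closed polygon with unit edges $\gamma$ can be domed if there is a dome over it: a finite connected 2-dimensional simplicial complex $\Sigma$ which is a compact surface whose boundary is a single cycle, with a map $f:\Sigma\to\mathbb{R}^3$ linear on each simplex, sending every triangle to an equilateral triangle of side $1$ and sending the boundary cycle of $\Sigma$ onto $\gamma$ vertex by vertex in cyclic order (no embedding/immersion required). *)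

(* Defs.v *)
From HB Require Import structures.
From mathcomp Require Import all_boot all_order all_algebra.
From mathcomp Require Import reals Rstruct.
From Stdlib Require Import Rdefinitions.

Set Implicit Arguments.
Unset Strict Implicit.
Unset Printing Implicit Defensive.

Import Order.TTheory GRing.Theory Num.Theory.
Local Open Scope ring_scope.

Definition point := 'rV[R]_3.

Definition dist (p q : point) : R :=
  Num.sqrt (\sum_(k < 3) (p 0 k - q 0 k) ^+ 2).

(* A closed polygon [v_1 ... v_n] (indices mod n, represented by 'I_n with
   successor ordS) all of whose edges have length 1. *)
Definition integral_curve (n : nat) (g : 'I_n -> point) : Prop :=
  forall i : 'I_n, dist (g i) (g (ordS i)) = 1.

Definition frechet (n : nat) (g g' : 'I_n -> point) : R :=
  \big[Num.max/0]_(i < n) dist (g i) (g' i).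

Section Complex.
Variable V : finType.
Variable T : {set {set V}}.

Definition tri_count (a b : V) : nat := #|[set t in T | (a \in t) && (b \in t)]|.

Definition edge_rel : rel V := fun a b => (a != b) && (0 < tri_count a b)%nat.

Definition link_rel (v : V) : rel V := fun a b => [set v; a; b] \in T.

Definition in_link (v a : V) : bool := (a != v) && (0 < tri_count v a)%nat.

Definition boundary_edge (a b : V) : bool := (a != b) && (tri_count a b == 1%nat).

(* Sigma is a finite, pure 2-dimensional simplicial complex which is a
   connected compact surface (with boundary): every simplex is a triangle or a
   face of one, every edge lies in 1 or 2 triangles, and the link of every
   vertex is connected (hence an arc or a circle). *)
Definition connected_surface : Prop :=
  [/\ forall t, t \in T -> #|t| = 3%nat,
      forall v : V, exists2 t, t \in T & v \in t,
      forall a b : V, a != b -> (tri_count a b <= 2)%nat,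
      forall v a c : V, in_link v a -> in_link v c -> connect (link_rel v) a c
    & forall a c : V, connect edge_rel a c].
End Complex.

(* gamma can be domed: there is a dome (Sigma, f) over it, i.e. a connected
   compact triangulated surface Sigma whose boundary is a single cycle
   b_0 ... b_{n-1}, and a simplexwise-linear map f (determined by its values
   on vertices) sending each triangle to a unit equilateral triangle and the
   boundary cycle onto gamma vertex by vertex in cyclic order. *)
Definition can_be_domed (n : nat) (g : 'I_n -> point) : Prop :=
  exists (V : finType) (T : {set {set V}}) (f : V -> point) (b : 'I_n -> V),
    [/\ connected_surface T,
        injective b,
        (forall x y : V, boundary_edge T x y <->
           exists i : 'I_n, (x = b i /\ y = b (ordS i)) \/ (y = b i /\ x = b (ordS i))),
        (forall t, t \in T -> forall x y, x \in t -> y \in t -> x != y ->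
           dist (f x) (f y) = 1)
      & forall i : 'I_n, f (b i) = g i].

(* Main.v *)
From mathcomp Require Import classical_sets topology normedtype realfun trigo.
From mathcomp Require Import lra ring.
Require Import Defs.
From HB Require Import structures.
From mathcomp Require Import all_boot all_order all_algebra.
From mathcomp Require Import reals Rstruct.
From Stdlib Require Import Rdefinitions.

Set Implicit Arguments.
Unset Strict Implicit.
Unset Printing Implicit Defensive.

Import Order.TTheory GRing.Theory Num.Theory.
Import numFieldNormedType.Exports.
Local Open Scope ring_scope.

(* Attaching triangles to a dome moves its boundary curve.  If P, X, Q are
   consecutive boundary vertices and X' is at distance 1 from P and Q, then a
   fan of unit triangles P = y_0, y_1, ..., y_k = Q around the axis X X', taken
   twice (with apices X and X'), replaces X by X'.  The fan closes up exactly
   for a dense set of X', by the intermediate value theorem with k large.  Hence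
   the closure of the set of domed curves is stable under rotating a vertex
   about the line through its (distinct) neighbours, under exchanging two
   adjacent edge vectors, thus under permuting all edge vectors, and under
   replacing an edge by two edges that span a unit triangle with it.

   It remains to shorten a closed curve with n >= 4 edges by such operations.
   Unless all edges are parallel (then one perturbs a pair u, -u), some three
   edge vectors u, v, w are such that rotating u and v about u + v gives u' with
   u'.w = -1/2; then u' + w is a unit vector and replaces the two edges u', w. *)

(** * Attaching triangles to a triangulated surface *)

(** All fan vertices lie on the circle of points at distance one from [X] and [X']. If [r] is its
    squared radius, a unit chord subtends the angle [t] with [2 r (1 - cos t) = 1], and [k] steps
    lead from [P] to [Q] when [cos (k t) = 1 - |PQ|^2 (1 - cos t)]. The fan may wind around the axis
    many times, which is harmless since a dome need not be immersed. What is not harmless is a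
    repeated simplex: a triangle may close a third edge only if that edge is still absent, and the
    freshness of the fan vertices ensures this. Since the fan closes only for a dense set of [X'],
    the moves are available for limits of domed curves only. The neighbours of the vertex then move
    too, and the new apex must depend continuously on them. This fails for [P = Q], whence the
    separate treatment of exchanges. The value -1/2 comes from [|u' + w|^2 = 2 + 2 u'.w]. The
    shortening is read backwards: the shorter curve is approximable by induction, down to a unit
    triangle, and the moves lead from it to the given curve. *)

Lemma connect_homo (V W : finType) (e : rel V) (e' : rel W) (f : V -> W) x y :
  (forall x y, e x y -> e' (f x) (f y)) ->
  connect e x y -> connect e' (f x) (f y).
Proof.
move=> ee' /connectP [p + ->]; elim: p x => [|z p IH] x //= /andP [exz pz].
by apply: connect_trans (IH _ pz); apply/connect1/ee'.
Qed.

Lemma connect_hub (V : finType) (e : rel V) (h : V) (P : pred V) :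
  symmetric e -> (forall x, P x -> connect e h x) ->
  forall x y, P x -> P y -> connect e x y.
Proof.
move=> se hP x y Px Py; apply: connect_trans (hP _ Py).
by rewrite (sym_connect_sym se) hP.
Qed.

(** Boundary cycles are sequences up to rotation: a triangle is attached at the head, and every
    other place is brought there by [rot 1]. *)
Definition cyclic_pairs (A : Type) (s : seq A) := zip s (rot 1 s).

Definition cyclic_adj (A : eqType) (s : seq A) (x y : A) : bool :=
  ((x, y) \in cyclic_pairs s) || ((y, x) \in cyclic_pairs s).

Lemma zip_rot1 (A B : Type) (s : seq A) (t : seq B) :
  size s = size t -> zip (rot 1 s) (rot 1 t) = rot 1 (zip s t).
Proof. by case: s t => [|a s] [|b t] // [st]; rewrite /= !rot1_cons zip_rcons. Qed.

Lemma cyclic_pairs_rot1 (A : Type) (s : seq A) :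
  cyclic_pairs (rot 1 s) = rot 1 (cyclic_pairs s).
Proof. by rewrite /cyclic_pairs zip_rot1 // size_rot. Qed.

Lemma cyclic_adj_rot1 (A : eqType) (s : seq A) :
  cyclic_adj (rot 1 s) =2 cyclic_adj s.
Proof. by move=> x y; rewrite /cyclic_adj cyclic_pairs_rot1 !mem_rot. Qed.

Lemma cyclic_pairs_map (A B : Type) (f : A -> B) (s : seq A) :
  cyclic_pairs (map f s) = map (fun p => (f p.1, f p.2)) (cyclic_pairs s).
Proof.
rewrite /cyclic_pairs -map_rot; move: (rot 1 s) => t.
by elim: s t => [|a s IH] [|b t] //=; rewrite IH.
Qed.

Lemma mem_zip_fst (A B : eqType) (s : seq A) (t : seq B) x y :
  (x, y) \in zip s t -> x \in s.
Proof.
elim: s t => [|a s IH] [|b t] //=; rewrite !inE.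
by case/orP=> [/eqP [-> _]|/IH ->]; rewrite ?eqxx ?orbT.
Qed.

Lemma mem_zip_snd (A B : eqType) (s : seq A) (t : seq B) x y :
  (x, y) \in zip s t -> y \in t.
Proof.
elim: s t => [|a s IH] [|b t] //=; rewrite !inE.
by case/orP=> [/eqP [_ ->]|/IH ->]; rewrite ?eqxx ?orbT.
Qed.

Section Surface.
Variable V : finType.
Implicit Types (T : {set {set V}}) (s : seq V).

Lemma tri_countC T x y : tri_count T x y = tri_count T y x.
Proof. by apply: eq_card => t; rewrite !inE [(x \in t) && _]andbC. Qed.

Lemma tri_countP T x y :
  reflect (exists2 t, t \in T & (x \in t) && (y \in t)) (0 < tri_count T x y)%nat.
Proof.
apply: (iffP card_gt0P) => -[t].
  by rewrite inE => /andP [tT xyt]; exists t.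
by move=> tT xyt; exists t; rewrite inE tT.
Qed.

Lemma link_rel_sym T v : symmetric (link_rel T v).
Proof. by move=> a b; rewrite /link_rel setUAC. Qed.

Lemma edge_rel_sym T : symmetric (edge_rel T).
Proof. by move=> a b; rewrite /edge_rel eq_sym tri_countC. Qed.

(* Unlike [connected_surface], this allows vertices lying in no triangle. *)
Definition surface_with_boundary T s : Prop :=
  [/\ forall t, t \in T -> #|t| = 3%nat,
      forall v a c, in_link T v a -> in_link T v c ->
        connect (link_rel T v) a c,
      forall a c, a \in cover T -> c \in cover T -> connect (edge_rel T) a c,
      forall x y, x != y -> (tri_count T x y <= 2)%nat
    & [/\ forall x y, boundary_edge T x y = cyclic_adj s x y, uniq s &
          (2 < size s)%nat]].

Lemma surface_rot1 T s :
  surface_with_boundary T s -> surface_with_boundary T (rot 1 s).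
Proof.
case=> h1 h2 h3 h4 [h5 h6 h7]; split=> //; split=> [x y||].
- by rewrite cyclic_adj_rot1.
- by rewrite rot_uniq.
- by rewrite size_rot.
Qed.

Section AddTriangle.
Variables (T : {set {set V}}) (a b c : V).
Hypotheses (nab : a != b) (nac : a != c) (nbc : b != c).
Hypothesis cntac : tri_count T a c = 0%nat.
Let t0 := [set a; b; c].
Let T' := t0 |: T.

Lemma tri_count_add x y :
  tri_count T' x y = (((x \in t0) && (y \in t0)) + tri_count T x y)%nat.
Proof.
have nT : t0 \notin T.
  apply/negP => tT; suff: (0 < tri_count T a c)%nat by rewrite cntac.
  by apply/tri_countP; exists t0; rewrite ?inE ?eqxx ?orbT.
rewrite /tri_count /T'; case: (boolP (_ && _)) => xy.
  rewrite (_ : finset _ = t0 |: [set t in T | (x \in t) && (y \in t)]).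
    by rewrite cardsU1 in_set (negPf nT).
  apply/setP => t; rewrite in_set !in_setU1 in_set.
  by case: (eqVneq t t0) => [->|].
apply: eq_card => t; rewrite in_set [RHS]in_set in_setU1.
by case: (eqVneq t t0) => [->|] //=; rewrite (negPf xy) andbF.
Qed.

Lemma sub_link_rel v : subrel (link_rel T v) (link_rel T' v).
Proof. by move=> x y; rewrite /link_rel /T' in_setU1 => ->; rewrite orbT. Qed.

Lemma sub_edge_rel : subrel (edge_rel T) (edge_rel T').
Proof.
move=> x y /andP [xy xyT]; rewrite /edge_rel xy tri_count_add.
by rewrite (leq_trans xyT) // leq_addl.
Qed.

Lemma in_link_add v x :
  in_link T' v x -> in_link T v x \/ [/\ v \in t0, x \in t0 & x != v].
Proof.
rewrite /in_link tri_count_add => /andP [xv].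
case: (boolP ((v \in t0) && (x \in t0))) => [/andP [-> ->] _|_ ->].
  by right.
by left; rewrite xv.
Qed.

Hypothesis cntab : tri_count T a b = 1%nat.
Hypothesis cntbc : (tri_count T b c <= 1)%nat.
Hypothesis linkc : forall x, in_link T c x -> in_link T c b.

(** Only the links of [a], [b], [c] change, each by the one new edge opposite to it. That edge meets
    the old link: [b] is already in the link of [a], [a] in that of [b], and the link of [c] is
    either empty or contains [b]. *)
Lemma add_link_connected :
  (forall v x y, in_link T v x -> in_link T v y ->
     connect (link_rel T v) x y) ->
  forall v x y, in_link T' v x -> in_link T' v y ->
    connect (link_rel T' v) x y.
Proof.
move=> conT v.
have mono x y : connect (link_rel T v) x y -> connect (link_rel T' v) x y.
  by apply: connect_sub => p q pq; apply/connect1/sub_link_rel.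
have hub h : (v \in t0 -> forall x, in_link T v x -> in_link T v h) ->
  (forall x, v \in t0 -> x \in t0 -> x != v -> connect (link_rel T' v) h x) ->
  forall x y, in_link T' v x -> in_link T' v y -> connect (link_rel T' v) x y.
  move=> oldh newh.
  have [vt|vt] := boolP (v \in t0); last first.
    move=> x y /in_link_add []; last by case=> /(negP vt).
    move=> vx /in_link_add []; last by case=> /(negP vt).
    by move=> vy; apply/mono/conT.
  apply: (@connect_hub _ _ h (in_link T' v)); first exact: link_rel_sym.
  move=> x /in_link_add [vx|[_ xt xv]]; last exact: newh.
  by apply/mono/conT => //; apply: oldh vx.
have tri x y z : [set x; y; z] = t0 -> connect (link_rel T' x) y z.
  by move=> e; apply: connect1; rewrite /link_rel e /T' in_setU1 eqxx.
have set_bac : [set b; a; c] = t0 by rewrite [[set b; a]]setUC.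
have set_cab : [set c; b; a] = t0 by rewrite setUC setUA setUAC.
have [va|va] := eqVneq v a; [|have [vb|vb] := eqVneq v b]; last first.
- have [vc|vc] := eqVneq v c; last first.
    by apply: (hub v) => [|x]; rewrite !inE (negPf va) (negPf vb) (negPf vc).
  subst v; apply: (hub b) => [_|x _]; first exact: linkc.
  by rewrite !inE => /orP [/orP [] |] /eqP ->; rewrite ?eqxx // => _;
    apply: tri.
- subst v; apply: (hub a) => [_ x _|x _].
    by rewrite /in_link nab tri_countC cntab.
  by rewrite !inE => /orP [/orP [] |] /eqP ->; rewrite ?eqxx // => _;
    apply: tri.
- subst v; apply: (hub b) => [_ x _|x _].
    by rewrite /in_link eq_sym nab cntab.
  by rewrite !inE => /orP [/orP [] |] /eqP ->; rewrite ?eqxx // => _;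
    apply: tri.
Qed.

Lemma cover_add v : (v \in cover T') = (v \in t0) || (v \in cover T).
Proof. by rewrite /T' /cover bigcup_setU big_set1 in_setU. Qed.

Lemma add_edge_connected :
  (forall x y, x \in cover T -> y \in cover T -> connect (edge_rel T) x y) ->
  forall x y, x \in cover T' -> y \in cover T' -> connect (edge_rel T') x y.
Proof.
move=> conT; apply: (@connect_hub _ _ a (mem (cover T'))).
  exact: edge_rel_sym.
have aT : a \in cover T.
  have /tri_countP [t tT /andP [at_ _]] : (0 < tri_count T a b)%nat.
    by rewrite cntab.
  by apply/bigcupP; exists t.
move=> x /=; rewrite cover_add => /orP [|xT]; last first.
  apply: connect_sub (conT _ _ aT xT) => p q pq.
  exact/connect1/sub_edge_rel.
rewrite in_setU in_set1 in_set2 => /orP [/orP [] |] /eqP -> //; apply: connect1.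
  by rewrite /edge_rel nab tri_count_add !inE !eqxx !orbT.
by rewrite /edge_rel nac tri_count_add !inE !eqxx !orbT.
Qed.

Lemma add_tri_count_le2 :
  (forall x y, x != y -> (tri_count T x y <= 2)%nat) ->
  forall x y, x != y -> (tri_count T' x y <= 2)%nat.
Proof.
move=> le2 x y xy; rewrite tri_count_add.
case: (boolP ((x \in t0) && (y \in t0))) => [|_]; last by rewrite le2.
rewrite add1n ltnS !inE => /andP [].
have cntE : [&& tri_count T a b <= 1, tri_count T a c <= 1,
  tri_count T b c <= 1, tri_count T b a <= 1, tri_count T c a <= 1
  & tri_count T c b <= 1]%nat.
  by rewrite [tri_count T b a]tri_countC [tri_count T c a]tri_countC
     [tri_count T c b]tri_countC cntab cntac cntbc.
case/and5P: cntE => ? ? ? ? /andP [? ?].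
move=> /orP [/orP [] |] /eqP ex /orP [/orP [] |] /eqP ey; subst x y => //;
  by rewrite eqxx in xy.
Qed.

Lemma add_card3 : (forall t, t \in T -> #|t| = 3%nat) ->
  forall t, t \in T' -> #|t| = 3%nat.
Proof.
move=> h t; rewrite in_setU1 => /orP [/eqP ->|/h //].
by rewrite /t0 setUC cardsU1 cards2 !inE nab [c == a]eq_sym [c == b]eq_sym
  (negPf nac) (negPf nbc).
Qed.
End AddTriangle.

Lemma boundary_edge_count1 T x y : boundary_edge T x y -> tri_count T x y = 1%nat.
Proof. by case/andP=> _ /eqP. Qed.

(* Both moves attach a triangle along the boundary edge [a b]: here [c] is a
   new vertex, in [surface_cut] it is the next boundary vertex. *)
Lemma surface_insert T a b c r :
  surface_with_boundary T [:: a, b & r] ->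
  c \notin cover T -> c \notin [:: a, b & r] ->
  surface_with_boundary ([set a; b; c] |: T) [:: a, c, b & r].
Proof.
case=> h1 h2 h3 h4 [h5 uq sz] cT cs.
have count_c x : tri_count T x c = 0%nat.
  apply/eqP; rewrite -leqn0 leqNgt; apply/tri_countP => -[t tT /andP [_ ct]].
  by case/negP: cT; apply/bigcupP; exists t.
have [nab nac nbc] : [/\ a != b, a != c & b != c].
  move: cs uq; rewrite !inE !negb_or /= !inE negb_or eq_sym.
  by case/and3P=> -> + _ /and3P [/andP [-> _] _ _]; rewrite eq_sym => ->.
have cab : tri_count T a b = 1%nat.
  apply: boundary_edge_count1.
  by rewrite h5 /cyclic_adj /cyclic_pairs rot1_cons /= !inE eqxx.
have cntac := count_c a.
have linkc x : in_link T c x -> in_link T c b.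
  by rewrite /in_link tri_countC count_c ltnn andbF.
have cntbc : (tri_count T b c <= 1)%nat by rewrite count_c.
split.
- exact: add_card3.
- exact: add_link_connected.
- exact: add_edge_connected.
- exact: add_tri_count_le2.
have uq' : uniq [:: a, c, b & r].
  move: uq cs; rewrite /= !inE !negb_or ![c == _]eq_sym.
  by case/and3P=> /andP [-> ->] -> -> /and3P [-> -> ->].
split=> //.
move=> x y; rewrite /boundary_edge tri_count_add //.
move: (h5 x y); rewrite /boundary_edge /cyclic_adj /cyclic_pairs !rot1_cons /=.
rewrite !in_cons !xpair_eqE; set L := zip _ _.
case: (boolP ((x \in [set a; b; c]) && (y \in [set a; b; c]))) => [|nxy].
  move=> xyt _; move: xyt.
  have /and4P [nA nC nB _] := uq'; rewrite !inE !negb_or in nA nC.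
  have L1 z : ((a, z) \in L) = false.
    by apply/negP=> /mem_zip_fst; apply/negP; rewrite inE negb_or; case/and3P: nA => _ -> ->.
  have L2 z : ((c, z) \in L) = false.
    by apply/negP=> /mem_zip_fst; apply/negP; rewrite inE negb_or.
  have L3 z : ((z, b) \in L) = false.
    apply/negP=> /mem_zip_snd; apply/negP.
    by rewrite mem_rcons inE negb_or eq_sym nab nB.
  have L4 z : ((z, c) \in L) = false.
    apply/negP=> /mem_zip_snd; apply/negP.
    by rewrite mem_rcons inE negb_or eq_sym nac; case/andP: nC => _ ->.
  (* The old cycle has more than two vertices: with [r] empty, [(b, a)] would be its closing
     pair. *)
  have L5 : ((b, a) \in L) = false.
    rewrite /L; case: (r) sz nA nB => [|d r'] //= _; rewrite !inE !negb_or.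
    rewrite xpair_eqE; case/and4P => _ _ nad nar /andP [nbd nbr].
    rewrite (negPf nad) andbF; apply/negP=> /mem_zip_fst.
    by rewrite inE (negPf nbd) (negPf nbr).
  rewrite !inE => /andP [].
  move=> /orP [/orP [] |] /eqP -> /orP [/orP [] |] /eqP ->;
    rewrite ?eqxx ?L1 ?L2 ?L3 ?L4 ?L5 ?[c == a]eq_sym ?[c == b]eq_sym ?[b == a]eq_sym
      ?(negPf nab) ?(negPf nac) ?(negPf nbc) ?count_c
      ?[tri_count T c _]tri_countC ?count_c
      ?[tri_count T b a]tri_countC ?cab //=.
rewrite add0n => ->; move: nxy; rewrite !inE.
by case: (x == a); case: (x == b); case: (x == c);
   case: (y == a); case: (y == b); case: (y == c).
Qed.

Lemma surface_cut T a b c r :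
  surface_with_boundary T [:: a, b, c & r] -> tri_count T a c = 0%nat ->
  surface_with_boundary ([set a; b; c] |: T) [:: a, c & r].
Proof.
case=> h1 h2 h3 h4 [h5 uq sz] cntac.
have /and4P [nA nB nC ur] := uq; rewrite !inE !negb_or in nA nB.
have [/andP [nab /andP [nac nar]] /andP [nbc nbr]] := (nA, nB).
have cab : tri_count T a b = 1%nat.
  apply: boundary_edge_count1.
  by rewrite h5 /cyclic_adj /cyclic_pairs rot1_cons /= !inE eqxx.
have cbc : tri_count T b c = 1%nat.
  apply: boundary_edge_count1.
  by rewrite h5 /cyclic_adj /cyclic_pairs rot1_cons /= !inE eqxx orbT.
have linkc x : in_link T c x -> in_link T c b.
  by rewrite /in_link nbc [tri_count T c b]tri_countC cbc.
have cntbc : (tri_count T b c <= 1)%nat by rewrite cbc.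
split.
- exact: add_card3.
- exact: add_link_connected.
- exact: add_edge_connected.
- exact: add_tri_count_le2.
split; last first.
(* The shortened cycle keeps three vertices: with [r] empty, [a c] would be a boundary edge, which
   [cntac] excludes. *)
- case: (r) cntac h5 => [|//] cntac h5.
  have : boundary_edge T a c.
    by rewrite h5 /cyclic_adj /cyclic_pairs rot1_cons /= !inE !eqxx !orbT.
  by move/boundary_edge_count1; rewrite cntac.
- by rewrite /= inE negb_or nac nar nC.
move=> x y; rewrite /boundary_edge tri_count_add //.
move: (h5 x y); rewrite /boundary_edge /cyclic_adj /cyclic_pairs !rot1_cons /=.
rewrite !in_cons !xpair_eqE; set L := zip _ _.
case: (boolP ((x \in [set a; b; c]) && (y \in [set a; b; c]))) => [|nxy].
  move=> xyt _; move: xyt.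
  have L1 z : ((a, z) \in L) = false.
    by apply/negP=> /mem_zip_fst; apply/negP; rewrite inE negb_or nac.
  have L2 z : ((b, z) \in L) = false.
    by apply/negP=> /mem_zip_fst; apply/negP; rewrite inE negb_or nbc.
  have L3 z : ((z, b) \in L) = false.
    apply/negP=> /mem_zip_snd; apply/negP.
    by rewrite mem_rcons inE negb_or eq_sym nab.
  have L4 z : ((z, c) \in L) = false.
    apply/negP=> /mem_zip_snd; apply/negP.
    by rewrite mem_rcons inE negb_or eq_sym nac.
  rewrite !inE => /andP [].
  by move=> /orP [/orP [] |] /eqP -> /orP [/orP [] |] /eqP ->;
    rewrite ?eqxx ?L1 ?L2 ?L3 ?L4 ?[c == a]eq_sym ?[c == b]eq_sym ?[b == a]eq_sym
      ?(negPf nab) ?(negPf nac) ?(negPf nbc)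
      ?[tri_count T c a]tri_countC ?[tri_count T c b]tri_countC
      ?[tri_count T b a]tri_countC
      ?cntac ?cbc ?cab ?orbT.
rewrite add0n => ->; move: nxy; rewrite !inE.
by case: (x == a); case: (x == b); case: (x == c);
   case: (y == a); case: (y == b); case: (y == c).
Qed.
End Surface.

(** * Enlarging the vertex set by a fresh vertex *)

Section Widen.
Variables (V : finType) (T : {set {set V}}).
Let T1 : {set {set option V}} := [set Some @: t | t : {set V} in T].

Lemma mem_imset_Some (x : V) (t : {set V}) : (Some x \in Some @: t) = (x \in t).
Proof. by rewrite mem_imset // => ? ? []. Qed.

Lemma None_notin_imset_Some (t : {set V}) : (None \in Some @: t) = false.
Proof. by apply/negP => /imsetP []. Qed.

Lemma imset_Some_inj : injective (fun t : {set V} => Some @: t).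
Proof. by apply: imset_inj => ? ? []. Qed.

Lemma cover_widen x : (x \in cover T1) = if x is Some y then y \in cover T else false.
Proof.
apply/bigcupP/idP => [[t /imsetP [t' t'T ->]]|].
  case: x => [x|]; last by rewrite None_notin_imset_Some.
  by rewrite mem_imset_Some => xt'; apply/bigcupP; exists t'.
case: x => // x /bigcupP [t tT xt]; exists (Some @: t).
  exact: imset_f.
by rewrite mem_imset_Some.
Qed.

Lemma tri_count_widen x y : tri_count T1 (Some x) (Some y) = tri_count T x y.
Proof.
rewrite /tri_count -(card_imset _ imset_Some_inj); apply: eq_card => t.
rewrite inE; apply/andP/imsetP => [[/imsetP [t' t'T ->]]|[t']].
  by rewrite !mem_imset_Some => xy; exists t' => //; rewrite inE t'T.
rewrite inE => /andP [t'T xy] ->; rewrite !mem_imset_Some; split=> //.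
exact: imset_f.
Qed.

Lemma in_link_widen v x : in_link T1 v x ->
  exists v' x', [/\ v = Some v', x = Some x' & in_link T v' x'].
Proof.
case/andP=> xv /tri_countP [t /imsetP [t' t'T ->] /andP []].
case: v xv => [v|]; last by rewrite None_notin_imset_Some.
case: x => [x|]; last by rewrite None_notin_imset_Some.
rewrite !mem_imset_Some => xv vt xt; exists v, x; split=> //.
by apply/andP; split=> //; apply/tri_countP; exists t' => //; apply/andP.
Qed.

Lemma surface_widen s : surface_with_boundary T s ->
  surface_with_boundary T1 (map Some s).
Proof.
have Sinj : injective (@Some V) by move=> ? ? [].
case=> h1 h2 h3 h4 [h5 uq sz]; split.
- by move=> t /imsetP [t' t'T ->]; rewrite card_imset // h1.
- move=> v a c /in_link_widen [v' [a' [-> -> va]]].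
  move=> /in_link_widen [v'' [c' [[<-] -> vc]]].
  apply: (connect_homo (f := Some) _ (h2 _ _ _ va vc)) => x y.
  rewrite /link_rel => /(imset_f (fun t : {set V} => Some @: t)).
  by rewrite !imsetU !imset_set1.
- move=> a c; rewrite !cover_widen; case: a => // a; case: c => // c aT cT.
  apply: (connect_homo (f := Some) _ (h3 _ _ aT cT)) => x y.
  by rewrite /edge_rel tri_count_widen.
- move=> x y xy; rewrite leqNgt; apply/negP => lt.
  have : in_link T1 x y by rewrite /in_link eq_sym xy (ltn_trans _ lt).
  case/in_link_widen=> x' [y' [ex ey _]]; subst x y; move: lt.
  by rewrite tri_count_widen ltnNge h4.
split; last by rewrite size_map.
- move=> x y; apply/idP/idP.
    move=> bxy; have : in_link T1 x y.
      by case/andP: bxy => xy /eqP e; rewrite /in_link eq_sym xy e.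
    case/in_link_widen=> x' [y' [ex ey _]]; subst x y; move: bxy.
    have := h5 x' y'; rewrite /boundary_edge tri_count_widen /= => -> .
    rewrite /cyclic_adj cyclic_pairs_map.
    by case/orP => h; apply/orP; [left|right]; apply/mapP;
      [exists (x', y')|exists (y', x')].
  rewrite /cyclic_adj cyclic_pairs_map => xy.
  have [x' [y' [ex ey]]] : exists x' y', [/\ x = Some x', y = Some y' & cyclic_adj s x' y'].
    by case/orP: xy => /mapP [[p q] pq [-> ->]]; [exists p, q|exists q, p];
      split=> //; rewrite /cyclic_adj pq ?orbT.
  by subst x y; rewrite -h5 /boundary_edge tri_count_widen.
- by rewrite map_inj_uniq.
Qed.
End Widen.

Lemma surface_triangle :
  surface_with_boundary [set [set: 'I_3]] (enum 'I_3).
Proof.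
have cnt x y : tri_count [set [set: 'I_3]] x y = 1%nat.
  rewrite /tri_count (_ : finset _ = [set [set: 'I_3]]) ?cards1 //.
  by apply/setP => t; rewrite !inE; case: eqP => [->|//]; rewrite !inE.
have enumE : enum 'I_3 = [:: 0; 1; 2].
  by apply: (inj_map val_inj); rewrite val_enum_ord.
split.
- by move=> t /set1P ->; rewrite cardsT card_ord.
- move=> v a c /andP [av _] /andP [cv _].
  have [<-|ac] := eqVneq a c; first exact: connect0.
  apply: connect1; rewrite /link_rel inE eqEcard subsetT cardsT card_ord.
  by rewrite setUC cardsU1 cards2 !inE negb_or cv eq_sym ac eq_sym av.
- move=> a c _ _; have [<-|ac] := eqVneq a c; first exact: connect0.
  by apply: connect1; rewrite /edge_rel ac cnt.
- by move=> x y _; rewrite cnt.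
split; last by rewrite size_enum_ord.
- move=> x y; rewrite /boundary_edge cnt enumE /cyclic_adj /cyclic_pairs /=.
  by rewrite !inE !xpair_eqE; case: x => -[|[|[|x]]] //= ?; case: y => -[|[|[|y]]].
- exact: enum_uniq.
Qed.

(** * Domes over polygons and the attaching of unit triangles *)

Definition unit_triangles (V : finType) (T : {set {set V}}) (f : V -> point) :=
  forall t, t \in T -> forall x y, x \in t -> y \in t -> x != y ->
    dist (f x) (f y) = 1.

(** The condition on [cover T] restores what [surface_with_boundary] leaves open: the intermediate
    complex that has the fresh vertex but not yet its triangle satisfies only the latter. *)
Definition dome (V : finType) (T : {set {set V}}) (f : V -> point) (s : seq V) :=
  [/\ surface_with_boundary T s, cover T = setT & unit_triangles T f].

Definition domed (S : seq point) : Prop :=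
  exists (V : finType) (T : {set {set V}}) (f : V -> point) (s : seq V),
    dome T f s /\ map f s = S.

Lemma distC p q : dist p q = dist q p.
Proof. by rewrite /dist; congr Num.sqrt; apply: eq_bigr => i _; rewrite -sqrrN opprB. Qed.

Lemma dome_adj_dist (V : finType) (T : {set {set V}}) f s x y :
  dome T f s -> cyclic_adj s x y -> dist (f x) (f y) = 1.
Proof.
case=> -[_ _ _ _ [h _ _]] _ uf; rewrite -h => /andP [xy /eqP c1].
have /tri_countP [t tT /andP [xt yt]] : (0 < tri_count T x y)%nat by rewrite c1.
exact: (uf t).
Qed.

Lemma dome_rot1 (V : finType) (T : {set {set V}}) f s :
  dome T f s -> dome T f (rot 1 s).
Proof. by case=> ? ? ?; split=> //; apply: surface_rot1. Qed.

Lemma unit_triangles_add (V : finType) (T : {set {set V}}) f a b c :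
  dist (f a) (f b) = 1 -> dist (f a) (f c) = 1 -> dist (f b) (f c) = 1 ->
  unit_triangles T f -> unit_triangles ([set a; b; c] |: T) f.
Proof.
move=> dab dac dbc uf t; rewrite in_setU1 => /orP [/eqP ->|tT]; last exact: uf.
move=> x y; rewrite !inE.
by move=> /orP [/orP [] |] /eqP -> /orP [/orP [] |] /eqP ->;
  rewrite ?eqxx // distC.
Qed.

(** The fresh vertex lies in the new triangle only. The second conclusion records this, since a
    later triangle that closes a third edge at this vertex needs that edge to be absent. *)
Lemma dome_insert (V : finType) (T : {set {set V}}) f a b r w :
  dome T f [:: a, b & r] -> dist (f a) w = 1 -> dist (f b) w = 1 ->
  exists T' : {set {set option V}},
    dome T' (oapp f w) [:: Some a, None, Some b & map Some r] /\
    forall z, z != Some a -> z != Some b -> z != None ->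
      tri_count T' None z = 0%nat.
Proof.
move=> dom daw dbw; have [su co ut] := dom.
have dab : dist (f a) (f b) = 1.
  apply: (dome_adj_dist dom).
  by rewrite /cyclic_adj /cyclic_pairs rot1_cons /= !inE eqxx.
set T1 : {set {set option V}} := [set Some @: t | t : {set V} in T].
have coN : None \notin cover T1 by rewrite cover_widen.
have cntN x : tri_count T1 None x = 0%nat.
  apply/eqP; rewrite -leqn0 leqNgt; apply/tri_countP => -[t tT /andP [Nt _]].
  by case/negP: coN; apply/bigcupP; exists t.
have [_ _ _ _ [_ uq _]] := su; move: (uq) => /andP [/norP [nab _] _].
exists ([set Some a; Some b; None] |: T1); split.
  split.
  - apply: surface_insert => //; first exact: surface_widen su.
    by rewrite -!map_cons; apply/mapP => -[].
  - apply/setP => x; rewrite cover_add in_setT cover_widen; case: x => [x|].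
      by rewrite co in_setT orbT.
    by rewrite !inE orbT.
  - apply: unit_triangles_add => // t /imsetP [t' t'T ->] x y.
    case: x => [x|]; last by rewrite None_notin_imset_Some.
    case: y => [y|]; last by rewrite None_notin_imset_Some.
    rewrite !mem_imset_Some => xt yt xy; exact: (ut t').
move=> z za zb zN; rewrite tri_count_add ?cntN //; last by rewrite tri_countC cntN.
by rewrite !inE (negPf za) (negPf zb) (negPf zN) andbF.
Qed.

Lemma dome_cut (V : finType) (T : {set {set V}}) f a b c r :
  dome T f [:: a, b, c & r] -> tri_count T a c = 0%nat ->
  dist (f a) (f c) = 1 -> dome ([set a; b; c] |: T) f [:: a, c & r].
Proof.
move=> dom cac dac; have [su co ut] := dom; split.
- exact: surface_cut.
- by apply/setP => x; rewrite cover_add co !inE orbT.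
- apply: unit_triangles_add => //; apply: (dome_adj_dist dom);
    by rewrite /cyclic_adj /cyclic_pairs rot1_cons /= !inE eqxx ?orbT.
Qed.

Lemma domed_rot1 S : domed S -> domed (rot 1 S).
Proof.
case=> V [T [f [s [dom <-]]]]; exists V, T, f, (rot 1 s).
by rewrite map_rot; split=> //; apply: dome_rot1.
Qed.

Lemma domed_rot S i : domed S -> domed (rot i S).
Proof.
move=> dS; have [le|/ltnW le] := leqP i (size S); last by rewrite rot_oversize.
elim: i le => [|i IH] le; first by rewrite rot0.
by rewrite rotS //; apply/domed_rot1/IH/ltnW.
Qed.

Lemma domed_unrot1 S : domed (rot 1 S) -> domed S.
Proof. by move=> /(domed_rot (size (rot 1 S) - 1)); rewrite -/(rotr _ _) rotK. Qed.

Lemma domed_triangle p q r :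
  dist p q = 1 -> dist q r = 1 -> dist r p = 1 -> domed [:: p; q; r].
Proof.
move=> pq qr rp; exists 'I_3, [set [set: 'I_3]].
exists (fun i : 'I_3 => nth 0 [:: p; q; r] i), (enum 'I_3); split.
  split; first exact: surface_triangle.
    by rewrite /cover big_set1.
  move=> t /set1P -> x y _ _.
  by case: x => -[|[|[|x]]] //= ?; case: y => -[|[|[|y]]] //= ? _ //;
    rewrite distC.
by rewrite (map_comp (nth 0 [:: p; q; r]) val) val_enum_ord.
Qed.

Lemma domed_insert P Q w R : domed [:: P, Q & R] ->
  dist P w = 1 -> dist Q w = 1 -> domed [:: P, w, Q & R].
Proof.
case=> V [T [f [[|a [|b r]] [dom]]]] //= [<- <- <-] Pw Qw.
have [T' [dom' _]] := dome_insert dom Pw Qw.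
exists (option V), T', (oapp f w), [:: Some a, None, Some b & map Some r].
by split=> //=; rewrite -map_comp.
Qed.

(** The triangles of apex [x] are attached one after the other along the boundary edge that enters
    [x]; the last one is a cut that buries [x] in the interior. Each new vertex takes over the role
    of [a], and being fresh it shares no triangle with [c]. *)
Lemma dome_fan (V : finType) (T : {set {set V}}) f a x c r (ys : seq point) :
  dome T f [:: a, x, c & r] -> tri_count T a c = 0%nat ->
  all (fun y => dist (f x) y == 1) ys ->
  path (fun p q => dist p q == 1) (f a) (rcons ys (f c)) ->
  domed ([:: f a & ys] ++ [:: f c & map f r]).
Proof.
elim: ys V T f a x c r => [|y ys IH] V T f a x c r dom cac /=.
  move=> _ /andP [/eqP dac _]; have dom' := dome_cut dom cac dac.
  by exists V, ([set a; x; c] |: T), f, [:: a, c & r].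
case/andP=> /eqP xy ally /andP [/eqP ay pth].
have [T' [dom' cnt']] := dome_insert dom ay xy.
have [[_ _ _ _ [_ + _]] _ _] := dom.
rewrite /= !inE !negb_or => /and3P [/and3P [ax ac _] /andP [xc _] _].
have cnt0 : tri_count T' None (Some c) = 0%nat by rewrite cnt' // eq_sym.
have := dome_rot1 dom'; rewrite rot1_cons => /IH /(_ cnt0 ally pth).
rewrite map_rcons -map_comp /= -[f c :: rcons _ _]rcons_cons -rcons_cat.
by rewrite -[y :: rcons _ _]rcons_cons -rot1_cons => /domed_unrot1.
Qed.

(** The edge from [x] sweeps along [y :: ys]: every cut glues the triangle on [x] and the next two
    boundary vertices and buries the first of these two. *)
Lemma dome_unfan (V : finType) (T : {set {set V}}) f x y c r ys :
  dome T f [:: x, y & ys ++ c :: r] ->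
  {in rcons ys c, forall z, tri_count T x z = 0%nat} ->
  {in rcons ys c, forall z, dist (f x) (f z) = 1} ->
  domed [:: f x, f c & map f r].
Proof.
elim: ys T y => [|z ys IH] T y /= dom cnt d.
  exists V, ([set x; y; c] |: T), f, [:: x, c & r]; split=> //.
  by apply: dome_cut => //; [apply: cnt|apply: d]; rewrite mem_seq1.
have cz : tri_count T x z = 0%nat by apply: cnt; rewrite inE eqxx.
have := dome_cut dom cz; rewrite d ?inE ?eqxx // => /(_ erefl) dom'.
have [[_ _ _ _ [_ + _]] _ _] := dom.
rewrite /= !inE !negb_or => /and4P [/and3P [xy xz nx] /andP [yz ny] nz _].
apply: (IH _ _ dom') => t tys; last by rewrite d // inE tys orbT.
have tr : t \in ys ++ c :: r.
  by move: tys; rewrite -cats1 !mem_cat !inE => /orP [] ->; rewrite ?orbT.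
rewrite tri_count_add // cnt ?addn0; last by rewrite inE tys orbT.
(* The boundary has no repeated vertex, so the triangle just glued contains none of the remaining
   fan vertices, and their counts with [x] stay zero. *)
suff -> : (t \in [set x; y; z]) = false by rewrite andbF.
rewrite !inE; apply/negbTE; rewrite !negb_or -andbA; apply/and3P.
by split; [apply: contraNneq nx|apply: contraNneq ny|apply: contraNneq nz] => <-.
Qed.

(* The two families of triangles [x y_i y_(i+1)] and [x' y_i y_(i+1)], with
   [y_0 = P] and [y_k = Q], make up the suspension of a path. *)
Lemma domed_suspension P X Q X' y ys R : domed [:: P, X, Q & R] ->
  all (fun z => dist X z == 1) (y :: ys) ->
  path (fun p q => dist p q == 1) P (y :: rcons ys Q) ->
  all (fun z => dist X' z == 1) [:: P, y & rcons ys Q] ->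
  domed [:: P, X', Q & R].
Proof.
case=> V [T [f [[|a [|x [|c r]]] [dom]]]] //= [<- <- <- <-].
move=> /= /andP [/eqP Xy allX] /andP [/eqP ay pth] /and3P [/eqP X'a /eqP X'y allX'].
have : domed [:: f a, y & ys ++ f c :: map f r].
  (* [y] is new, so no triangle contains it together with [c]. For [a] and [c] nothing of the kind
     is known, which is why the fan has at least one inner point [y]. *)
  have [T' [dom' cnt']] := dome_insert dom ay Xy.
  have [[_ _ _ _ [_ + _]] _ _] := dom.
  rewrite /= !inE !negb_or => /and3P [/and3P [ax ac _] /andP [xc _] _].
  have cnt0 : tri_count T' None (Some c) = 0%nat by rewrite cnt' // eq_sym.
  have := dome_rot1 dom'; rewrite rot1_cons => /dome_fan /(_ cnt0 allX pth).
  rewrite map_rcons -map_comp /= -[f c :: rcons _ _]rcons_cons -rcons_cat.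
by rewrite -[y :: rcons _ _]rcons_cons -rot1_cons => /domed_unrot1.
case=> W [U [h [[|a' [|y' l]] [domU]]]] //= [ea ey el].
rewrite distC in X'a; rewrite distC in X'y.
rewrite -ea in X'a *; rewrite -ey in X'y.
have [T' [dom' cnt']] := dome_insert domU X'a X'y.
(* The fan yields another dome, known only through its polygon; its boundary vertices are sorted
   into fan and rest by position. *)
have [ys' [c' [r' [el1 e2 e3 e4]]]] : exists ys' c' r',
    [/\ l = ys' ++ c' :: r', map h ys' = ys, h c' = f c & map h r' = map f r].
  have lt : (size ys < size l)%nat.
    by rewrite -(size_map h) el size_cat /= -addn1 leq_add2l.
  case: (l) lt el => // l0 l1 lt el.
  exists (take (size ys) (l0 :: l1)), (nth l0 (l0 :: l1) (size ys)), (drop (size ys).+1 (l0 :: l1)).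
  rewrite -drop_nth // cat_take_drop map_take map_drop el take_size_cat //.
  rewrite drop_cat ltnNge leqnSn /= subSnn /= ?drop0; split=> //.
  by rewrite -(nth_map _ (f c)) // el nth_cat ltnn subnn.
apply: domed_unrot1; rewrite rot1_cons -e3 -e4.
have := dome_rot1 dom'; rewrite rot1_cons el1 map_cat /= rcons_cat /=.
have [[_ _ _ _ [_ + _]] _ _] := domU.
rewrite el1 /= !inE !negb_or => /and3P [/andP [ay' al] yl _].
have sub z : z \in rcons (map Some ys') (Some c') ->
   exists2 u, z = Some u & u \in rcons ys' c'.
  by rewrite -map_rcons => /mapP [u ? ->]; exists u.
have sub2 u : u \in rcons ys' c' -> u \in ys' ++ c' :: r'.
  by rewrite -cats1 !mem_cat !inE => /orP [] ->; rewrite ?orbT.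
move=> /dome_unfan; rewrite map_rcons -map_comp /=; apply=> z /sub [u -> us].
  rewrite cnt' //; [apply: contraNneq al|apply: contraNneq yl]; move=> [<-]; exact: sub2.
apply/eqP; apply: (allP allX'); rewrite -e2 -e3 -map_rcons; exact: map_f.
Qed.

Lemma cyclic_pairsP (A : eqType) (x0 : A) n (s : seq A) x y : size s = n ->
  reflect (exists i : 'I_n, x = nth x0 s i /\ y = nth x0 s (ordS i))
    ((x, y) \in cyclic_pairs s).
Proof.
move=> ss; have szr : size s = size (rot 1 s) by rewrite size_rot.
have nth_rot i : (i < n)%nat -> nth x0 (rot 1 s) i = nth x0 s (i.+1 %% n).
  rewrite -ss; case: (s) => // a l; rewrite rot1_cons nth_rcons ltnS leq_eqVlt.
  case/orP=> [/eqP ->|il]; first by rewrite ltnn eqxx modnn.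
  by rewrite il modn_small.
apply: (iffP (nthP (x0, x0))) => [[i]|[i [-> ->]]].
  rewrite size_zip -szr minnn ss => lt; rewrite nth_zip // nth_rot //.
  by case=> <- <-; exists (Ordinal lt).
exists (val i); first by rewrite size_zip -szr minnn ss; apply: ltn_ord.
by rewrite nth_zip // nth_rot //; apply: ltn_ord.
Qed.

Lemma domed_can_be_domed n (S : seq point) : size S = n -> domed S ->
  can_be_domed (fun i : 'I_n => nth 0 S i).
Proof.
move=> sS [V [T [f [s [dom eS]]]]]; have [[h1 h2 h3 h4 [h5 uq sz]] co ut] := dom.
have ss : size s = n by rewrite -sS -eS size_map.
have [v0 _] : exists v0, v0 \in s.
  by case: (s) sz => // v0 s' _; exists v0; rewrite inE eqxx.
exists V, T, f, (fun i : 'I_n => nth v0 s i); split=> //.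
- split=> //.
  + by move=> v; have: v \in cover T by [rewrite co inE]; case/bigcupP => t tT vt; exists t.
  + by move=> a c; apply: h3; rewrite co inE.
- move=> i j /eqP; rewrite nth_uniq ?ss ?ltn_ord // => /eqP; exact: val_inj.
- have pairsP x y := @cyclic_pairsP _ v0 n s x y ss.
  move=> x y; rewrite h5 /cyclic_adj; split.
    by case/orP=> /pairsP [i [-> ->]]; exists i; [left|right].
  by case=> i [] [-> ->]; apply/orP; [left|right]; apply/pairsP; exists i.
- by move=> i; rewrite -eS (nth_map v0) // ss.
Qed.

Lemma domed_pair_dist S p q : domed S -> (p, q) \in cyclic_pairs S -> dist p q = 1.
Proof.
case=> V [T [f [s [dom <-]]]]; rewrite cyclic_pairs_map => /mapP [[x y] xy [-> ->]].
by apply: (dome_adj_dist dom); rewrite /cyclic_adj xy.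
Qed.

(** * Closing up a fan of unit triangles *)

Local Notation pi := trigo.pi.

Lemma cos_natmul_pi (K : realType) (j : nat) :
  cos (j%:R * pi) = (-1) ^+ odd j :> K.
Proof.
elim: j => [|j IH]; first by rewrite mul0r cos0.
by rewrite -natr1 mulrDl mul1r cosDpi IH /= -signrN.
Qed.

(* [cos (k t)] oscillates between -1 and 1 on an arbitrarily short interval
   around [t0] when [k] is large, so it meets any continuous function with
   values in [-1, 1]. *)
Lemma cos_natmul_hits (K : realType) (t0 c : K) (P : set K) :
  0 <= t0 -> 0 <= c -> c * (1 - cos t0) < 2 -> (\forall t \near t0, P t) ->
  exists (k : nat) (t : K),
    [/\ (2 <= k)%nat, P t & cos (k%:R * t) = 1 - c * (1 - cos t)].
Proof.
move=> t00 c0 ct0 Pt0.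
have cont : continuous (fun t : K => c * (1 - cos t)).
  move=> t; apply: cvgM; first exact: cvg_cst.
  by apply: cvgB; [exact: cvg_cst|exact: continuous_cos].
have : \forall t \near t0, P t /\ c * (1 - cos t) < 2.
  near=> t; split; near: t => //.
  exact: (cvgr_lt _ (cont t0)).
case/nbhs_ballP=> e /= e0 ballP.
have pi0 := pi_gt0 K.
(* The shift by two gives [2 <= k] and [pi / k < e], so the cell of the grid of multiples of
   [pi / k] that contains [t0] stays within the ball. *)
pose k := (Num.trunc (pi / e)).+2.
have kpi : pi / k%:R < e.
  rewrite ltr_pdivrMr ?ltr0n // mulrC -ltr_pdivrMr //.
  have -> : k = ((Num.trunc (pi / e)).+1).+1 by [].
  apply: lt_trans (truncnS_gt _) _; by rewrite ltr_nat.
have k0 : 0 < k%:R :> K by rewrite ltr0n.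
pose j := Num.trunc (t0 * k%:R / pi).
have /andP [j1 j2] : j%:R <= t0 * k%:R / pi < j.+1%:R.
  by apply: truncn_itv; rewrite divr_ge0 ?mulr_ge0 // ltW.
pose a : K := j%:R * pi / k%:R; pose b : K := j.+1%:R * pi / k%:R.
have at0 : a <= t0.
  by rewrite /a ler_pdivrMr // -ler_pdivlMr.
have t0b : t0 < b by rewrite /b ltr_pdivlMr // -ltr_pdivrMr.
have ab : b - a < e by rewrite /a /b -natr1 mulrDl mul1r mulrDl addrC addKr.
have inP t : a <= t <= b -> P t /\ c * (1 - cos t) < 2.
  move=> /andP [at_ tb]; apply: ballP; rewrite /ball /= ltr_norml; apply/andP; split; lra.
have ge0 t : 0 <= c * (1 - cos t) by rewrite mulr_ge0 // subr_ge0 cos_le1.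
have [|||t] := @IVT K (fun t => cos (k%:R * t) + c * (1 - cos t)) a b 1.
- by rewrite (le_trans at0) // ltW.
- apply: continuous_subspaceT => t; apply: cvgD; last exact: cont.
  apply: (@cvg_comp _ _ _ (fun t : K => k%:R * t) (@cos K)); last exact: continuous_cos.
  by apply: cvgM; [exact: cvg_cst|exact: cvg_id].
- have ->: k%:R * a = j%:R * pi by rewrite /a mulrC divfK // gt_eqF.
  have ->: k%:R * b = j.+1%:R * pi by rewrite /b mulrC divfK // gt_eqF.
  (* At the two ends the cosine is 1 and -1 in some order, while the other summand lies between 0
     and 2; so the sum is at least 1 at one end and at most 1 at the other. *)
  rewrite !cos_natmul_pi /=.
  have [_ /ltW la] := inP a ltac:(lra); have [_ /ltW lb] := inP b ltac:(lra).
  have ga := ge0 a; have gb := ge0 b.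
  rewrite ge_min le_max; case: (odd j); rewrite ?expr0 ?expr1; apply/andP; split; apply/orP.
  + left; lra.
  + right; lra.
  + right; lra.
  + left; lra.
rewrite in_itv /= => tab e1; exists k, t; split=> //; first by case: (inP t tab).
lra.
Unshelve. all: by end_near. Qed.

(* [al] and [be] are the coordinates of the rotated point; the third condition
   makes consecutive points of the fan unit distance apart, the last but one
   closes the fan up after [k] steps. *)
Lemma rotation_parameters (K : realType) (rho g e : K) :
  0 < rho <= 1 -> - (rho / 2) < g < rho -> 0 < e ->
  let sig := rho - g ^+ 2 / rho in
  exists (k : nat) (t al be : K),
    [/\ [/\ (2 <= k)%nat & al < 1],
        al ^+ 2 * rho + be ^+ 2 * sig = rho,
        (4 - 2 * rho * (1 - al)) * (1 - cos t) = 2,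
        cos (k%:R * t) = 1 - 4 * (1 - rho) * (1 - cos t)
      & (al - g / rho) ^+ 2 * rho + (be - 1) ^+ 2 * sig < e].
Proof.
move=> /andP [rho0 rho1] /andP [g1 g2] e0 sig.
have sig0 : 0 < sig.
  have h : 0 < (rho - g) * (rho + g) by apply: mulr_gt0; lra.
  by rewrite /sig subr_gt0 ltr_pdivrMr //; lra.
(* [y0] is a quarter of the squared distance that the vertex travels, and the fan runs on a circle
   of squared radius [1 - y0]. A unit chord needs [y0] to be at most 3/4; the lower bound on [g]
   gives [y0 < 3 / 4 * rho]. *)
pose y0 := (rho - g) / 2; have y0E : y0 = (rho - g) / 2 by [].
have [y00 y01] : 0 < y0 /\ y0 < 3 / 4 * rho by split; lra.
have y02 : 0 < 1 - y0 by lra.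
pose u0 := 1 - (2 * (1 - y0))^-1.
have inv0 : 0 < (2 * (1 - y0))^-1 by rewrite invr_gt0; lra.
have inv1 : (2 * (1 - y0))^-1 <= 2.
  by rewrite -[2 in X in _ <= X]invrK lef_pV2 ?posrE ?invr_gt0 //; lra.
have u0b : -1 <= u0 <= 1 by rewrite /u0; lra.
pose t0 := acos u0; have ct0 : cos t0 = u0 by rewrite acosK // in_itv.
have u0E : 1 - cos t0 = (2 * (1 - y0))^-1 by rewrite ct0 /u0; ring.
(* The unit chord condition [2 * (1 - y) * (1 - cos t) = 1], solved for [y], with [t] the angle of
   one step; [al] follows from [2 * rho * (1 - al) = 4 * y]. *)
pose y (t : K) := 1 - (2 * (1 - cos t))^-1.
pose al t := 1 - 2 * y t / rho.
pose be t := Num.sqrt ((rho - al t ^+ 2 * rho) / sig).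
have yt0 : y t0 = y0.
  by rewrite /y u0E invfM invrK; field; lra.
have alt0 : al t0 = g / rho by rewrite /al yt0 /y0; field; lra.
have bet0 : be t0 = 1.
  rewrite /be alt0 (_ : _ / sig = 1) ?sqrtr1 //.
  rewrite (_ : rho - _ = sig) ?divff //; first by rewrite gt_eqF.
  by rewrite /sig; field; lra.
have cy : (y t @[t --> t0] --> y t0)%classic.
  apply: cvgB; first exact: cvg_cst.
  apply: cvgV; first by rewrite u0E mulf_eq0 !gt_eqF.
  apply: cvgM; first exact: cvg_cst.
  by apply: cvgB; [exact: cvg_cst|exact: continuous_cos].
have cal : (al t @[t --> t0] --> al t0)%classic.
  apply: cvgB; first exact: cvg_cst.
  apply: cvgM; last exact: cvg_cst.
  by apply: cvgM => //; exact: cvg_cst.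
have cal2 : (al t ^+ 2 * rho @[t --> t0] --> al t0 ^+ 2 * rho)%classic.
  by apply: cvgM; [apply: cvgM|exact: cvg_cst].
have cbe : (be t @[t --> t0] --> be t0)%classic.
  apply: (@cvg_comp _ _ _ _ (@Num.sqrt K)); last exact: sqrt_continuous.
  by apply: cvgM; [apply: cvgB => //; exact: cvg_cst|exact: cvg_cst].
pose D t := (al t - g / rho) ^+ 2 * rho + (be t - 1) ^+ 2 * sig.
have cD : (D t @[t --> t0] --> D t0)%classic.
  apply: cvgD; (apply: cvgM; last exact: cvg_cst); apply: cvgM;
    by apply: cvgB => //; exact: cvg_cst.
have D0 : D t0 = 0 by rewrite /D alt0 bet0 !subrr expr0n /= !mul0r addr0.
have near_t0 : \forall t \near t0, [/\ 0 < y t, y t < rho & D t < e].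
  near=> t; split; near: t.
  - by apply: (cvgr_gt _ cy); rewrite yt0.
  - by apply: (cvgr_lt _ cy); rewrite yt0; lra.
  - by apply: (cvgr_lt _ cD); rewrite D0.
(* [4 * (1 - rho)] is the squared distance of the two neighbours. The upper bound to check amounts
   to [y0 < rho]: their chord is shorter than a diameter of the fan's circle. *)
have [||| k [t [k2 [yt1 yt2 Dt] ckt]]] := @cos_natmul_hits K t0 (4 * (1 - rho)) _ _ _ _ near_t0.
- by rewrite acos_ge0.
- lra.
- by rewrite u0E ltr_pdivrMr; lra.
exists k, t, (al t), (be t).
have alE : rho * (1 - al t) = 2 * y t by rewrite /al; field; lra.
have al1 : al t < 1.
  by rewrite -subr_gt0 -(pmulr_rgt0 _ rho0) alE; lra.
have al2 : -1 < al t by rewrite /al; rewrite ltrBrDr -ltrBrDl ltr_pdivrMr //; lra.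
split=> //.
- rewrite /be sqr_sqrtr ?divfK ?gt_eqF //; first by ring.
  by rewrite divr_ge0 ?(ltW sig0) //; nra.
- rewrite (_ : 2 * rho * _ = 4 * y t); last by rewrite -mulrA alE; ring.
  have ct1 : 1 - cos t != 0.
    by apply: contraTneq yt2 => e1; rewrite /y e1 mulr0 invr0 -leNgt; lra.
  by rewrite /y; field.
Unshelve. all: by end_near. Qed.

(** * Euclidean geometry of unit vectors *)

Definition dot (u v : point) : R := \sum_(k < 3) u 0 k * v 0 k.

Lemma dotC u v : dot u v = dot v u.
Proof. by apply: eq_bigr => k _; rewrite mulrC. Qed.

Lemma dotDl u v w : dot (u + v) w = dot u w + dot v w.
Proof. by rewrite -big_split; apply: eq_bigr => k _; rewrite mxE mulrDl. Qed.

Lemma dotZl a u w : dot (a *: u) w = a * dot u w.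
Proof. by rewrite mulr_sumr; apply: eq_bigr => k _; rewrite mxE mulrA. Qed.

Lemma dotNl u w : dot (- u) w = - dot u w.
Proof. by rewrite -scaleN1r dotZl mulN1r. Qed.

Lemma dot0l u : dot 0 u = 0.
Proof. by rewrite -(scale0r 0) dotZl mul0r. Qed.

Lemma dotDr u v w : dot w (u + v) = dot w u + dot w v.
Proof. by rewrite !(dotC w) dotDl. Qed.

Lemma dotZr a u w : dot w (a *: u) = a * dot w u.
Proof. by rewrite !(dotC w) dotZl. Qed.

Lemma dotNr u w : dot w (- u) = - dot w u.
Proof. by rewrite !(dotC w) dotNl. Qed.

Definition dotE := (dotDl, dotDr, dotZl, dotZr, dotNl, dotNr).

Lemma dot_ge0 u : 0 <= dot u u.
Proof. by apply: sumr_ge0 => k _; rewrite -expr2 sqr_ge0. Qed.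

Lemma dot_eq0 u : (dot u u == 0) = (u == 0).
Proof.
apply/idP/eqP => [|->]; last by rewrite dot0l.
rewrite psumr_eq0 => [/allP h|k _]; last by rewrite -expr2 sqr_ge0.
apply/rowP => k; rewrite mxE; apply/eqP.
by have := h k (mem_index_enum _); rewrite -expr2 sqrf_eq0.
Qed.

Lemma dot_gt0 u : (0 < dot u u) = (u != 0).
Proof. by rewrite lt_neqAle dot_ge0 andbT eq_sym dot_eq0. Qed.

Lemma dot_CauchySchwarz u v : dot u v ^+ 2 <= dot u u * dot v v.
Proof.
have [->|v0] := eqVneq v 0; first by rewrite dotC !dot0l expr0n mulr0.
have vv : 0 < dot v v by rewrite dot_gt0.
have := dot_ge0 (dot v v *: u - dot u v *: v).
rewrite !dotE (dotC v u) => h.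
suff: 0 <= dot v v * (dot u u * dot v v - dot u v ^+ 2).
  by rewrite pmulr_rge0 // subr_ge0.
by apply: le_trans h _; rewrite le_eqVlt; apply/orP; left; apply/eqP; ring.
Qed.

(** The 3 by 2 matrix with columns [u] and [v] has rank at most 2, so some nonzero row vector
    annihilates both, even when they are dependent. *)
Lemma exists_unit_orthogonal (u v : point) :
  exists w, [/\ dot w w = 1, dot w u = 0 & dot w v = 0].
Proof.
pose A := row_mx u^T v^T.
have : kermx A != 0.
  rewrite -mxrank_eq0 mxrank_ker -lt0n subn_gt0.
  exact: leq_ltn_trans (rank_leq_col _) _.
case/rowV0Pn => w /sub_kermxP wA w0.
have [wu wv] : dot w u = 0 /\ dot w v = 0.
  move: wA; rewrite mul_mx_row -[0]hsubmxK => /eq_row_mx [] /rowP /(_ 0) h1 /rowP /(_ 0) h2.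
  move: h1 h2; rewrite !mxE => h1 h2.
  by split; [rewrite -h1|rewrite -h2]; apply: eq_bigr => k _; rewrite mxE.
have ww : 0 < dot w w by rewrite dot_gt0.
have sq := sqr_sqrtr (ltW ww).
have s0 : Num.sqrt (dot w w) != 0 by rewrite sqrtr_eq0 -ltNge.
exists ((Num.sqrt (dot w w))^-1 *: w); rewrite !dotE wu wv !mulr0; split=> //.
by rewrite -[X in _ * (_ * X)]sq; field.
Qed.

Definition norm (u : point) : R := Num.sqrt (dot u u).

Lemma norm_ge0 u : 0 <= norm u.
Proof. exact: sqrtr_ge0. Qed.

Lemma norm_sqr u : norm u ^+ 2 = dot u u.
Proof. by rewrite sqr_sqrtr // dot_ge0. Qed.

Lemma norm_eq0 u : (norm u == 0) = (u == 0).
Proof. by rewrite -dot_eq0 -norm_sqr sqrf_eq0. Qed.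

Lemma norm_gt0 u : (0 < norm u) = (u != 0).
Proof. by rewrite lt_neqAle norm_ge0 andbT eq_sym norm_eq0. Qed.

Lemma normN u : norm (- u) = norm u.
Proof. by rewrite /norm !dotE opprK. Qed.

Lemma normZ a u : norm (a *: u) = `|a| * norm u.
Proof.
by rewrite /norm !dotE mulrA -expr2 sqrtrM ?sqr_ge0 // sqrtr_sqr.
Qed.

Lemma dot_le_norm u v : `|dot u v| <= norm u * norm v.
Proof.
rewrite -ler_sqr ?nnegrE ?mulr_ge0 ?norm_ge0 //.
by rewrite real_normK ?num_real // exprMn !norm_sqr dot_CauchySchwarz.
Qed.

Lemma norm_triangle u v : norm (u + v) <= norm u + norm v.
Proof.
rewrite -ler_sqr ?nnegrE ?addr_ge0 ?norm_ge0 // norm_sqr !dotE (dotC v u).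
have := ler_norm (dot u v); have := dot_le_norm u v.
rewrite -!norm_sqr; nra.
Qed.

Lemma dist_norm p q : dist p q = norm (p - q).
Proof.
by rewrite /dist /norm /dot; congr Num.sqrt; apply: eq_bigr => k _; rewrite !mxE expr2.
Qed.

Lemma dist_eq1 p q : dist p q = 1 <-> dot (p - q) (p - q) = 1.
Proof.
rewrite dist_norm; split=> [h|h]; first by rewrite -norm_sqr h expr1n.
by rewrite /norm h sqrtr1.
Qed.

Lemma distpp p : dist p p = 0.
Proof. by apply/eqP; rewrite dist_norm subrr norm_eq0. Qed.

Lemma dist_triangle q p r : dist p r <= dist p q + dist q r.
Proof.
by rewrite !dist_norm; apply: le_trans (norm_triangle _ _); rewrite addrA subrK.
Qed.

(** * Rotating a vertex of a domed curve *)

Ltac vec := apply/rowP => ?; rewrite !mxE; lra.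

Lemma domed_head_dist P X S : domed [:: P, X & S] -> dist P X = 1.
Proof.
case=> V [T [f [[|a [|b r]] [dom]]]] //= [<- <- _].
apply: (dome_adj_dist dom).
by rewrite /cyclic_adj /cyclic_pairs rot1_cons /= !inE eqxx.
Qed.

Lemma domed_head_dist2 P X Q S : domed [:: P, X, Q & S] -> dist X Q = 1.
Proof. by move/domed_rot1; rewrite rot1_cons => /domed_head_dist. Qed.

Lemma path_map_iota (A : Type) (e : rel A) (f : nat -> A) m k :
  (forall i, e (f i) (f i.+1)) -> path e (f m) (map f (iota m.+1 k)).
Proof. by move=> h; elim: k m => //= k IH m; rewrite h IH. Qed.

(** [W'] completes [W] to an orthogonal frame of the plane normal to [E] in which [Z] appears at the
    angle with cosine [c] and sine [s]. The sign of [s] orients the frame; for [s = 0] the vector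
    [Z] is a multiple of [W] and any normal direction serves. *)
Lemma rotation_frame (W Z E : point) (r c s : R) :
  c ^+ 2 + s ^+ 2 = 1 -> 0 < r -> dot W W = r -> dot Z Z = r ->
  dot W E = 0 -> dot Z E = 0 -> dot Z W = r * c ->
  exists W', [/\ dot W' W' = r, dot W W' = 0, dot W' E = 0
               & Z = c *: W + s *: W'].
Proof.
move=> cs r0 WW ZZ WE ZE ZW.
have [s0|s0] := eqVneq s 0.
  have [w [ww wW wE]] := exists_unit_orthogonal W E.
  exists (Num.sqrt r *: w); rewrite !dotE ww (dotC W) wW wE !mulr0.
  rewrite mulr1 -expr2 sqr_sqrtr ?(ltW r0) //; split=> //.
  rewrite s0 scale0r addr0; apply/eqP; rewrite -subr_eq0 -dot_eq0 !dotE.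
  rewrite ZZ (dotC W) ZW WW; apply/eqP.
  have c2 : c ^+ 2 = 1 by rewrite -cs s0 expr0n addr0.
  transitivity (r * (1 - c ^+ 2)); first by ring.
  by rewrite c2 subrr mulr0.
have s2 : s ^+ 2 = 1 - c ^+ 2 by rewrite -cs; ring.
exists (s^-1 *: (Z - c *: W)); split.
- rewrite !dotE ZZ (dotC W) ZW WW.
  transitivity (r * (1 - c ^+ 2) / s ^+ 2); first by field.
  by rewrite -s2 mulfK // expf_neq0.
- by rewrite !dotE (dotC W) ZW WW; ring.
- by rewrite !dotE WE ZE; ring.
- by rewrite scalerA divff // scale1r addrC subrK.
Qed.

(** [P] and [Q] lie on a circle about the midpoint [N] of [X X'] all of whose points have distance
    one from [X] and [X']. The two equations say that a unit chord subtends the angle [t] and that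
    [k] such steps lead from [P] to [Q]. *)
Lemma domed_rotate_exact P X Q X' R (k : nat) (t : Rdefinitions.R) :
  domed [:: P, X, Q & R] -> dist P X' = 1 -> dist Q X' = 1 -> (2 <= k)%nat ->
  (4 - dot (X' - X) (X' - X)) * (1 - cos t) = 2 ->
  cos (k%:R * t) = 1 - dot (Q - P) (Q - P) * (1 - cos t) ->
  domed [:: P, X', Q & R].
Proof.
move=> dom PX' QX' k2 ht hk.
have PX := domed_head_dist dom; have QX := domed_head_dist2 dom.
rewrite distC in QX.
pose E := 2^-1 *: (X' - X); pose N := 2^-1 *: (X' + X).
pose W := P - N; pose Z := Q - N.
have [W1 W2] : dot (W + E) (W + E) = 1 /\ dot (W - E) (W - E) = 1.
  rewrite (_ : W + E = P - X); last by rewrite /W /E /N; vec.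
  rewrite (_ : W - E = P - X'); last by rewrite /W /E /N; vec.
  by split; apply/dist_eq1.
have [Z1 Z2] : dot (Z + E) (Z + E) = 1 /\ dot (Z - E) (Z - E) = 1.
  rewrite (_ : Z + E = Q - X); last by rewrite /Z /E /N; vec.
  rewrite (_ : Z - E = Q - X'); last by rewrite /Z /E /N; vec.
  by split; apply/dist_eq1.
have XE : X' - X = 2 *: E by rewrite /E; vec.
have QP : Q - P = Z - W by rewrite /Z /W; vec.
have PN : P = N + W by rewrite /W; vec.
have QN : Q = N + Z by rewrite /Z; vec.
have XN : X = N + (-1) *: E by rewrite /N /E; vec.
have X'N : X' = N + 1 *: E by rewrite /N /E; vec.
clearbody W Z E N.
move: W1 W2 Z1 Z2 ht hk; rewrite XE QP !dotE (dotC E W) (dotC E Z) (dotC W Z).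
set r := dot W W => W1 W2 Z1 Z2 ht hk.
have WE : dot W E = 0 by lra.
have ZE : dot Z E = 0 by lra.
have EE : dot E E = 1 - r by lra.
have ZZ : dot Z Z = r by lra.
have rc : 2 * r * (1 - cos t) = 1.
  by move: ht; rewrite EE; lra.
have r0 : 0 < r.
  have c1 : 0 <= 1 - cos t by rewrite subr_ge0 cos_le1.
  rewrite lt_neqAle dot_ge0 andbT eq_sym; apply/eqP => r0.
  by move: rc; rewrite r0; lra.
have ZW : dot Z W = r * cos (k%:R * t).
  rewrite hk ZZ; transitivity (r - r * (1 - cos t) * 2 * r + r * (1 - cos t) * 2 * dot Z W); last by ring.
  have -> : r * (1 - cos t) * 2 = 1 by lra.
  by ring.
have [W' [W'W' WW' W'E ZWW']] := rotation_frame (cos2Dsin2 _) r0 erefl ZZ WE ZE ZW.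
pose pt (m : nat) := N + cos (m%:R * t) *: W + sin (m%:R * t) *: W'.
have pt0 : pt 0%nat = P.
  by rewrite /pt mul0r cos0 sin0 scale1r scale0r addr0.
have ptk : pt k = Q by rewrite /pt -addrA -ZWW'.
have cs m := cos2Dsin2 (m%:R * t).
have step m : dist (pt m) (pt m.+1) == 1.
  apply/eqP/dist_eq1; rewrite /pt.
  set c := cos _; set s := sin _; set c' := cos _; set s' := sin _.
  rewrite (_ : _ - _ = (c - c') *: W + (s - s') *: W'); last by vec.
  rewrite !dotE (dotC W') WW' W'W' -/r.
  have cc : c * c' + s * s' = cos t.
    rewrite mulrC [s * _]mulrC -cosB -mulrBl -natr1 addrAC subrr add0r.
    by rewrite mul1r.
  have := cs m; have := cs m.+1; rewrite -/c -/s -/c' -/s' => h1 h2.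
  transitivity (r * ((c ^+ 2 + s ^+ 2) + (c' ^+ 2 + s' ^+ 2) - 2 * (c * c' + s * s'))); first by ring.
  by rewrite cc h1 h2; lra.
(* The sign [sg] treats both apices at once: [X] is [N - E] and [X'] is [N + E]. *)
have distE (sg : Rdefinitions.R) m : sg ^+ 2 = 1 -> dist (N + sg *: E) (pt m) == 1.
  move=> sg2; apply/eqP/dist_eq1; rewrite /pt.
  set c := cos _; set s := sin _.
  rewrite (_ : _ - _ = sg *: E - c *: W - s *: W'); last by vec.
  rewrite !dotE (dotC W' W) (dotC E W) (dotC E W') WW' W'W' WE W'E EE -/r.
  transitivity (sg ^+ 2 * (1 - r) + r * (c ^+ 2 + s ^+ 2)); first by ring.
  by rewrite cs sg2; ring.
have Xpt m : dist X (pt m) == 1.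
  by rewrite XN; apply: distE; rewrite sqrrN expr1n.
have X'pt m : dist X' (pt m) == 1.
  by rewrite X'N; apply: distE; rewrite expr1n.
have kE : iota 2 k.-1 = rcons (iota 2 k.-2) k.
  have [k' ->] : exists k', k = k'.+2 by case: (k) k2 => [|[|k']] // _; exists k'.
  by rewrite /= -[2 :: iota 3 k']/(iota 2 k'.+1) -[k'.+1 in LHS]addn1 iotaD cats1.
apply: (@domed_suspension P X Q X' (pt 1%nat) (map pt (iota 2 k.-2))) dom _ _ _.
- by rewrite /= Xpt all_map; apply/allP => m _; apply: Xpt.
- have := @path_map_iota _ (fun p q => dist p q == 1) pt 0%nat k step.
  by rewrite pt0 -[k in iota _ k](prednK (ltnW k2)) /= kE map_rcons ptk.
- rewrite /= -{1}pt0 !X'pt -ptk -map_rcons all_map; apply/allP => m _; exact: X'pt.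
Qed.

(** Adding and subtracting the two squared side lengths separates height and base. The apices over
    [P Q] thus form a circle about the midpoint [M] in the plane normal to [H], on which all
    rotations below take place. *)
Lemma apex_decomposition (P Q X M H : point) :
  M = 2^-1 *: (P + Q) -> H = 2^-1 *: (Q - P) ->
  dist P X = 1 /\ dist Q X = 1 <->
  dot (X - M) H = 0 /\ dot (X - M) (X - M) + dot H H = 1.
Proof.
move=> eM eH; rewrite !dist_eq1.
have -> : P - X = - ((X - M) + H) by rewrite eM eH; vec.
have -> : Q - X = - ((X - M) - H) by rewrite eM eH; vec.
move: (X - M) => A; rewrite !dotE (dotC H A).
by split=> -[h1 h2]; split; lra.
Qed.

(** The bound on the dot product says that the turn about [P Q] is by less than [2 pi / 3], which
    keeps [X X'] short enough for a circle with unit chords. *)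
Lemma domed_rotate_near P X Q X0 R eps :
  domed [:: P, X, Q & R] -> dist P X0 = 1 -> dist Q X0 = 1 -> X0 != X ->
  let M := 2^-1 *: (P + Q) in
  - (dot (X - M) (X - M) / 2) < dot (X - M) (X0 - M) -> 0 < eps ->
  exists X', [/\ dist X0 X' < eps, dist P X' = 1, dist Q X' = 1
               & domed [:: P, X', Q & R]].
Proof.
move=> dom PX0 QX0 nX M gM e0.
have PX := domed_head_dist dom; have QX := domed_head_dist2 dom.
rewrite distC in QX.
pose H := 2^-1 *: (Q - P); have eM : M = 2^-1 *: (P + Q) by [].
have eH : H = 2^-1 *: (Q - P) by [].
have [AH] := (apex_decomposition X eM eH).1 (conj PX QX).
have [BH] := (apex_decomposition X0 eM eH).1 (conj PX0 QX0).
have QP : Q - P = 2 *: H by rewrite /H; vec.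
pose A := X - M; pose B := X0 - M.
have XA : X = M + A by rewrite /A; vec.
have XB : X0 = M + B by rewrite /B; vec.
have nAB : B - A != 0 by apply: contra_neq nX => h; rewrite XA XB -[B](subrK A) h add0r.
rewrite -/A -/B in AH BH gM *; clearbody M H A B.
set rho := dot A A in gM * => BB AA.
pose g := dot A B; have gE : dot A B = g by [].
rewrite gE in gM.
have BBr : dot B B = rho by lra.
have g2 : g < rho.
  by move: nAB; rewrite -dot_gt0 !dotE (dotC B) gE BBr -/rho; lra.
have rho0 : 0 < rho by have := dot_ge0 A; rewrite -/rho; lra.
have rho1 : rho <= 1 by have := dot_ge0 H; lra.
have [||| k [t [al [be [[k2 al1] albe ht hk near_]]]]] :=
    @rotation_parameters _ rho g (eps ^+ 2).
- by rewrite rho0.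
- by rewrite gM.
- by rewrite exprn_gt0.
(* Gram-Schmidt: [X0 - M] has the coordinates [g / rho] and 1 along [A] and [B'], and [al], [be] are
   small changes of these. *)
pose B' := B - (g / rho) *: A.
have AB' : dot A B' = 0.
  by rewrite /B' !dotE gE -/rho; field; lra.
have B'B' : dot B' B' = rho - g ^+ 2 / rho.
  by rewrite /B' !dotE (dotC B) gE BBr -/rho; field; lra.
have B'H : dot B' H = 0 by rewrite /B' !dotE AH BH; ring.
have BB' : B = (g / rho) *: A + B' by rewrite /B' addrC subrK.
clearbody B'.
pose X' := M + al *: A + be *: B'.
have X'M : X' - M = al *: A + be *: B' by rewrite /X'; vec.
have [PX' QX'] : dist P X' = 1 /\ dist Q X' = 1.
  apply/(apex_decomposition X' eM eH); rewrite X'M !dotE AH B'H (dotC B') AB' B'B' -/rho.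
  split; first by ring.
  by rewrite -AA -[in RHS]albe; ring.
exists X'; split=> //.
- rewrite dist_norm -(ltr_pXn2r (_ : 0 < 2)%nat) ?nnegrE ?norm_ge0 ?(ltW e0) // norm_sqr.
  rewrite (_ : X0 - X' = (g / rho - al) *: A + (1 - be) *: B'); last first.
    by rewrite /X' XB BB'; vec.
  rewrite !dotE (dotC B') AB' B'B' -/rho.
  by apply: le_lt_trans near_; rewrite le_eqVlt; apply/orP; left; apply/eqP; ring.
- apply: (domed_rotate_exact (t := t) dom PX' QX' k2).
    rewrite -[RHS]ht; congr (_ * _); congr (_ - _).
    rewrite (_ : X' - X = (al - 1) *: A + be *: B'); last by rewrite /X' XA; vec.
    rewrite !dotE (dotC B') AB' B'B' -/rho.
    transitivity (al ^+ 2 * rho + be ^+ 2 * (rho - g ^+ 2 / rho) + (1 - 2 * al) * rho).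
      by ring.
    by rewrite albe; ring.
  by rewrite hk QP !dotE; congr (_ - _ * _); lra.
Qed.

(** An obtuse turn is made in two, with a stopover near an apex [M + C] whose direction makes equal,
    non-obtuse angles with those of [X] and [X0]. *)
Lemma domed_rotate_dense P X Q X0 R eps :
  domed [:: P, X, Q & R] -> dist P X0 = 1 -> dist Q X0 = 1 -> 0 < eps ->
  exists2 X', dist X0 X' < eps & domed [:: P, X', Q & R].
Proof.
move=> dom PX0 QX0 e0.
have [eX|nX] := eqVneq X0 X; first by exists X => //; rewrite eX distpp.
have PX := domed_head_dist dom; have QX := domed_head_dist2 dom.
rewrite distC in QX.
pose M := 2^-1 *: (P + Q); pose H := 2^-1 *: (Q - P).
have eM : M = 2^-1 *: (P + Q) by [].
have eH : H = 2^-1 *: (Q - P) by [].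
have [AH AA] := (apex_decomposition X eM eH).1 (conj PX QX).
have [BH BB] := (apex_decomposition X0 eM eH).1 (conj PX0 QX0).
have rho0 : 0 < dot (X - M) (X - M).
  rewrite dot_gt0; apply: contraTneq nX => A0; rewrite negbK.
  have /eqP B0 : X0 - M == 0.
    by rewrite -dot_eq0; apply/eqP; move: AA BB; rewrite A0 dot0l; lra.
  by rewrite -[X0](subrK M) -[X](subrK M) A0 B0.
have rotate_near Y Y0 : domed [:: P, Y, Q & R] -> dist P Y0 = 1 -> dist Q Y0 = 1 -> Y0 != Y ->
    - (dot (Y - M) (Y - M) / 2) < dot (Y - M) (Y0 - M) -> forall e, 0 < e ->
  exists Y', [/\ dist Y0 Y' < e, dist P Y' = 1, dist Q Y' = 1
               & domed [:: P, Y', Q & R]].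
  by move=> domY PY QY nY h e he; apply: (domed_rotate_near domY PY QY nY h he).
have [gpos|gneg] := leP 0 (dot (X - M) (X0 - M)).
  have [|X' [h1 _ _ h2]] := rotate_near X X0 dom PX0 QX0 nX _ eps e0; first lra.
  by exists X'.
pose rho := dot (X - M) (X - M).
have BBr : dot (X0 - M) (X0 - M) = rho by rewrite /rho; lra.
(* a quarter-turn direction on the circle, seeing [X] and [X0] equally *)
have [C [CC CH CAB CA0]] : exists C, [/\ dot C C = rho, dot C H = 0,
    dot C (X - M) = dot C (X0 - M) & 0 <= dot C (X - M)].
  have [w [ww wH wAB]] := exists_unit_orthogonal H ((X - M) - (X0 - M)).
  pose C := Num.sqrt rho *: w.
  have CC : dot C C = rho by rewrite /C !dotE ww mulr1 -expr2 sqr_sqrtr // ltW.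
  have CH : dot C H = 0 by rewrite /C dotZl wH mulr0.
  have CAB : dot C (X - M) = dot C (X0 - M).
    by apply/eqP; rewrite -subr_eq0 -dotNr -dotDr /C dotZl wAB mulr0.
  have [h|h] := leP 0 (dot C (X - M)); first by exists C.
  exists (- C); rewrite !(dotNl, dotNr) opprK CC CH CAB oppr0; split=> //.
  by rewrite -CAB; lra.
have CnA : M + C != X.
  apply/eqP => eX; have eC : C = X - M by rewrite -eX; vec.
  by move: CAB; rewrite eC; lra.
have CM : M + C - M = C by vec.
have [PC QC] : dist P (M + C) = 1 /\ dist Q (M + C) = 1.
  by apply/(apex_decomposition (M + C) eM eH); rewrite CM CC -AA.
have s0 : 0 < norm (X0 - M) by rewrite /norm BBr sqrtr_gt0.
(* The stopover [X1] misses [M + C] by less than half the radius, so the dot product with [X0 - M]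
   loses less than half the squared radius, as the second turn permits. *)
have [|X1 [near1 PX1 QX1 dom1]] := rotate_near X (M + C) dom PC QC CnA _ (norm (X0 - M) / 2) (divr_gt0 s0 (ltr0Sn _ _)).
  by rewrite CM (dotC _ C); lra.
have [eX1|nX1] := eqVneq X0 X1; first by exists X1 => //; rewrite eX1 distpp.
have [AH1 AA1] := (apex_decomposition X1 eM eH).1 (conj PX1 QX1).
have [|X' [h1 _ _ h2]] := rotate_near X1 X0 dom1 PX0 QX0 nX1 _ eps e0; last by exists X'.
have -> : dot (X1 - M) (X1 - M) = norm (X0 - M) ^+ 2 by rewrite norm_sqr; lra.
have -> : X1 - M = C - (M + C - X1) by vec.
rewrite !dotDl dotNl -CAB.
have := dot_le_norm (M + C - X1) (X0 - M); rewrite -dist_norm.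
have := ler_norm (dot (M + C - X1) (X0 - M)).
nra.
Qed.

(** [X - M] is projected to the plane normal to the new base and rescaled to the new height [r].
    Since [P != Q], the direction of the base is stable; since [X] is off the midpoint, so is that
    of the height. *)
Lemma apex_near P Q X eps :
  P != Q -> dist P X = 1 -> dist Q X = 1 -> X != 2^-1 *: (P + Q) -> 0 < eps ->
  exists2 d, 0 < d & forall P1 Q1, dist P P1 < d -> dist Q Q1 < d ->
    exists X1, [/\ dist X X1 < eps, dist P1 X1 = 1 & dist Q1 X1 = 1].
Proof.
move=> nPQ PX QX nXM e0.
pose M := 2^-1 *: (P + Q); pose H := 2^-1 *: (Q - P).
have eM : M = 2^-1 *: (P + Q) by [].
have eH : H = 2^-1 *: (Q - P) by [].
have [AH AA] := (apex_decomposition X eM eH).1 (conj PX QX).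
pose A := X - M; have XA : X = M + A by rewrite /A; vec.
rewrite -/A in AH AA.
pose a := norm A; pose h := norm H.
have a0 : 0 < a by rewrite norm_gt0 subr_eq0.
clearbody A M H.
have h0 : 0 < h.
  rewrite norm_gt0; apply: contra_neq nPQ => h0.
  by apply/eqP; rewrite eq_sym -subr_eq0 -[Q - P](scalerK (_ : 2^-1 != 0)) ?invr_eq0 ?pnatr_eq0 // -eH h0 scaler0.
have ah : a ^+ 2 + h ^+ 2 = 1 by rewrite !norm_sqr.
have a1 : a < 1 by nra.
have h1 : h < 1 by nra.
(* The summands bound the shift of the midpoint, twice the tilt [norm (B - A)] (with [a < 1]), and
   the change of height from [a] to [r]. *)
pose K := 1 + 4 / h + 2 / a.
have K0 : 0 < K.
  by have := divr_gt0 (ltr0Sn _ 3) h0; have := divr_gt0 (ltr0Sn _ 1) a0; rewrite /K; lra.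
(* [h / 2] keeps the new base nondegenerate, and [1 - h] keeps it shorter than 2, so that
   [1 - k ^+ 2] has a genuine square root [r]. *)
pose d := Num.min (Num.min (h / 2) (1 - h)) (eps / K).
have [d1 d2 d3] : [/\ d <= h / 2, d <= 1 - h & d * K <= eps].
  rewrite -ler_pdivlMr // /d !ge_min !lexx !orbT; split=> //.
have d0 : 0 < d by rewrite /d !lt_min !divr_gt0 //= subr_gt0 h1.
exists d => // P1 Q1 dP dQ.
pose M1 := 2^-1 *: (P1 + Q1); pose H1 := 2^-1 *: (Q1 - P1).
have half0 : `|2^-1 : R| = 2^-1 by rewrite ger0_norm // invr_ge0.
have dM : norm (M - M1) < d.
  have -> : M - M1 = 2^-1 *: ((P - P1) + (Q - Q1)) by rewrite eM /M1; vec.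
  rewrite normZ half0; have := norm_triangle (P - P1) (Q - Q1).
  by rewrite -!dist_norm; lra.
have dH : norm (H1 - H) < d.
  have -> : H1 - H = 2^-1 *: ((P - P1) - (Q - Q1)) by rewrite eH /H1; vec.
  rewrite normZ half0; have := norm_triangle (P - P1) (- (Q - Q1)).
  by rewrite normN -!dist_norm; lra.
have eM1 : M1 = 2^-1 *: (P1 + Q1) by [].
have eH1 : H1 = 2^-1 *: (Q1 - P1) by [].
clearbody M1 H1.
pose eta := norm (H1 - H); pose k := norm H1.
have eta0 : 0 <= eta := norm_ge0 _.
have hk1 : k <= h + eta.
  by rewrite /k -[H1](subrK H) addrC; apply: norm_triangle.
have hk2 : h <= k + eta.
  rewrite /k /h /eta -[norm (H1 - H)]normN opprB -[H in norm H](subrK H1) addrC.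
  exact: norm_triangle.
rewrite -/eta in dH.
have k0 : 0 < k by lra.
have k1 : k < 1 by lra.
have kH : dot H1 H1 = k ^+ 2 by rewrite norm_sqr.
pose m := dot A H1.
have mb : `|m| <= a * eta.
  rewrite /m -[H1](subrK H) dotDr AH addr0; exact: dot_le_norm.
pose B := A - (m / k ^+ 2) *: H1; have eB : B = A - (m / k ^+ 2) *: H1 by [].
have BH : dot B H1 = 0 by rewrite /B !dotE kH -/m divfK ?subrr // expf_neq0 // gt_eqF.
clearbody B.
have dB : norm (B - A) <= 2 * a * eta / h.
  have -> : B - A = (- (m / k ^+ 2)) *: H1 by rewrite eB; vec.
  rewrite normZ -/k normrN normrM normfV normrX (ger0_norm (ltW k0)).
  have -> : `|m| / k ^+ 2 * k = `|m| / k by field; rewrite gt_eqF.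
  rewrite ler_pdivrMr // mulrAC ler_pdivlMr //.
  have := normr_ge0 m; nra.
pose b := norm B.
have ba1 : a <= b + norm (B - A).
  have := norm_triangle B (A - B).
  by rewrite [B + _]addrC subrK -[norm (A - B)]normN opprB.
have ba2 : b <= a + norm (B - A).
  by have := norm_triangle A (B - A); rewrite [A + _]addrC subrK.
have small : 2 * a * eta / h < a.
  rewrite ltr_pdivrMr //; nra.
have b0 : 0 < b by lra.
pose r := Num.sqrt (1 - k ^+ 2).
have r2 : r ^+ 2 = 1 - k ^+ 2 by rewrite sqr_sqrtr //; nra.
have r0 : 0 <= r := sqrtr_ge0 _.
have ra : `|r - a| <= 2 * eta / a.
  rewrite ler_pdivlMr //.
  have f : (r - a) * (r + a) = (h - k) * (h + k).
    by rewrite -!subr_sqr r2; lra.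
  have f2 : `|r - a| * (r + a) = `|h - k| * (h + k).
    have := congr1 Num.norm f; rewrite !normrM.
    by rewrite (ger0_norm (_ : 0 <= r + a)) ?(ger0_norm (_ : 0 <= h + k)) //; lra.
  have hk : `|h - k| <= eta by rewrite ler_norml; lra.
  have := normr_ge0 (r - a); have := normr_ge0 (h - k); nra.
pose X1 := M1 + (r / b) *: B.
exists X1; have X1M : X1 - M1 = (r / b) *: B by rewrite /X1; vec.
have [-> ->] : dist P1 X1 = 1 /\ dist Q1 X1 = 1.
  apply/(apex_decomposition X1 eM1 eH1).
  rewrite X1M !dotE BH kH -norm_sqr -/b; split; first by rewrite mulr0.
  transitivity (r ^+ 2 + k ^+ 2); last by rewrite r2 subrK.
  by field; rewrite gt_eqF.
split=> //.
have -> : dist X X1 = norm ((M - M1) - ((r / b - 1) *: B + (B - A))).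
  by rewrite dist_norm; congr norm; rewrite XA /X1; vec.
apply: le_lt_trans (norm_triangle _ _) _; rewrite normN.
have := norm_triangle ((r / b - 1) *: B) (B - A).
have -> : norm ((r / b - 1) *: B) = `|r - b|.
  rewrite normZ -/b -[X in _ * X](ger0_norm (ltW b0)) -normrM; congr Num.norm.
  by field; rewrite gt_eqF.
have rb : `|r - b| <= `|r - a| + norm (B - A).
  have := ler_norm (r - a); have := ler_norm (- (r - a)); rewrite normrN ler_norml; lra.
have bound : 2 * (2 * a * eta / h) + 2 * eta / a <= eta * (K - 1).
  rewrite /K; have -> : eta * (1 + 4 / h + 2 / a - 1) = 4 * eta / h + 2 * eta / a.
    by field; rewrite !gt_eqF.
  rewrite lerD2r !mulrA ler_pM2r ?invr_gt0 //; nra.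
have : eta * (K - 1) <= d * (K - 1).
  rewrite ler_wpM2r ?ltW //.
  by have := divr_gt0 (ltr0Sn _ 3) h0; have := divr_gt0 (ltr0Sn _ 1) a0; rewrite /K; lra.
lra.
Qed.

(** * Curves approximable by domed ones *)

Definition close (e : R) : seq point -> seq point -> bool :=
  all2 (fun p q => dist p q < e).

Definition approximable (S : seq point) : Prop :=
  forall e, 0 < e -> exists2 S', close e S S' & domed S'.

Lemma close_refl e S : 0 < e -> close e S S.
Proof. by move=> e0; elim: S => //= p S ->; rewrite distpp e0. Qed.

Lemma close_le e1 e2 S S' : e1 <= e2 -> close e1 S S' -> close e2 S S'.
Proof.
move=> le; elim: S S' => [|p S IH] [|q S'] //= /andP [pq SS'].
by rewrite (lt_le_trans pq le) IH.
Qed.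

Lemma close_trans e1 e2 S1 S2 S3 :
  close e1 S1 S2 -> close e2 S2 S3 -> close (e1 + e2) S1 S3.
Proof.
elim: S1 S2 S3 => [|p S1 IH] [|q S2] [|r S3] //= /andP [pq h1] /andP [qr h2].
rewrite (IH _ _ h1 h2) andbT; apply: le_lt_trans (dist_triangle q _ _) _.
exact: ltrD.
Qed.

Lemma close_rot1 e S S' : close e S S' -> close e (rot 1 S) (rot 1 S').
Proof.
rewrite /close !all2E !size_rot => /andP [/eqP sz h].
by rewrite sz eqxx zip_rot1 // (eq_all_r (mem_rot 1 _)).
Qed.

Lemma domed_approximable S : domed S -> approximable S.
Proof. by move=> dS e e0; exists S => //; apply: close_refl. Qed.

Lemma approximable_rot1 S : approximable S -> approximable (rot 1 S).
Proof.
move=> h e /h [S' SS' dS']; exists (rot 1 S'); first exact: close_rot1.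
exact: domed_rot1.
Qed.

Lemma approximable_rot S i : approximable S -> approximable (rot i S).
Proof.
move=> dS; have [le|/ltnW le] := leqP i (size S); last by rewrite rot_oversize.
elim: i le => [|i IH] le; first by rewrite rot0.
by rewrite rotS //; apply/approximable_rot1/IH/ltnW.
Qed.

Lemma approximable_limit S :
  (forall e, 0 < e -> exists2 S', close e S S' & approximable S') ->
  approximable S.
Proof.
move=> h e e0; have e2 : 0 < e / 2 by rewrite divr_gt0.
have [S' SS' /(_ _ e2) [S'' SS'' dS'']] := h _ e2.
by exists S'' => //; rewrite [e](splitr e); apply: close_trans SS' SS''.
Qed.

(** The approximating domed curves have moved neighbours [P1], [Q1]. So [X'] is carried over to an
    exact apex [X2] above them, which density of the rotations replaces by a reachable [X3]. *)
Lemma approximable_rotate P X Q X' S :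
  P != Q -> dist P X = 1 -> dist Q X = 1 -> dist P X' = 1 -> dist Q X' = 1 ->
  approximable [:: P, X, Q & S] -> approximable [:: P, X', Q & S].
Proof.
move=> nPQ PX QX PX' QX' ap.
have [->//|nX] := eqVneq X' X.
(* If [X'] were the midpoint, [P Q] would have length 2 and [X] could only be the midpoint too. *)
have nX'M : X' != 2^-1 *: (P + Q).
  apply: contra_neq nX => eX'.
  have [_ AA] := (apex_decomposition X erefl erefl).1 (conj PX QX).
  have [_ BB] := (apex_decomposition X' erefl erefl).1 (conj PX' QX').
  rewrite eX' subrr dot0l in BB.
  have /eqP : dot (X - 2^-1 *: (P + Q)) (X - 2^-1 *: (P + Q)) = 0 by lra.
  by rewrite dot_eq0 subr_eq0 => /eqP ->.
move=> e e0; have e2 : 0 < e / 2 by rewrite divr_gt0.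
have [d d0 apex] := apex_near nPQ PX' QX' nX'M e2.
have [|S1] := ap (Num.min d e); first by rewrite lt_min d0.
case: S1 => [|P1 [|X1 [|Q1 S1]]] //=; rewrite ?andbF // !lt_min.
case/and4P => /andP [P1d P1e] _ /andP [Q1d Q1e] SS1 dom.
have [X2 [X2e PX2 QX2]] := apex _ _ P1d Q1d.
have [X3 X3e dom3] := domed_rotate_dense dom PX2 QX2 e2.
exists [:: P1, X3, Q1 & S1] => //=; rewrite P1e Q1e (close_le _ SS1) ?ge_min ?lexx ?orbT // !andbT.
by apply: le_lt_trans (dist_triangle X2 _ _) _; rewrite [e](splitr e); apply: ltrD.
Qed.

(* Needed because [approximable_rotate] does not apply when [P = Q]. *)
Lemma approximable_swap P X Q S :
  approximable [:: P, X, Q & S] -> approximable [:: P, P + Q - X, Q & S].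
Proof.
move=> ap e e0; have e4 : 0 < e / 4 by rewrite divr_gt0.
have [[|P1 [|X1 [|Q1 S1]]]] := ap _ e4; rewrite //= ?andbF //.
case/and4P => P1e X1e Q1e SS1 dom.
have PX := domed_head_dist dom; have QX := domed_head_dist2 dom.
(* The fourth vertex of the parallelogram is an exact apex and depends continuously on the other
   three, wherever they lie. The errors of these three and of the rotation use up the four quarters
   of [e]. *)
have P2 : dist P1 (P1 + Q1 - X1) = 1.
  by rewrite -QX !dist_norm; congr norm; vec.
have Q2 : dist Q1 (P1 + Q1 - X1) = 1.
  by rewrite -PX [RHS]distC !dist_norm; congr norm; vec.
have [X3 X3e dom3] := domed_rotate_dense dom P2 Q2 e4.
have lt : e / 4 < e by lra.
exists [:: P1, X3, Q1 & S1] => //=; rewrite (lt_trans P1e lt) (lt_trans Q1e lt).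
rewrite (close_le (ltW lt) SS1) !andbT.
apply: le_lt_trans (dist_triangle (P1 + Q1 - X1) _ _) _.
have -> : dist (P + Q - X) (P1 + Q1 - X1) = norm ((P - P1) + ((Q - Q1) + (X1 - X))).
  by rewrite dist_norm; congr norm; vec.
have := norm_triangle (P - P1) ((Q - Q1) + (X1 - X)).
have := norm_triangle (Q - Q1) (X1 - X).
by rewrite -!dist_norm (distC X1); lra.
Qed.

Lemma approximable_insert P X Q S :
  dist P Q = 1 -> dist P X = 1 -> dist Q X = 1 ->
  approximable [:: P, Q & S] -> approximable [:: P, X, Q & S].
Proof.
move=> PQ PX QX ap e e0; have e2 : 0 < e / 2 by rewrite divr_gt0.
have nPQ : P != Q.
  by apply/eqP => ePQ; move: PQ; rewrite ePQ distpp => /esym/eqP; rewrite oner_eq0.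
have nXM : X != 2^-1 *: (P + Q).
  apply/eqP => eX; have [_] := (apex_decomposition X erefl erefl).1 (conj PX QX).
  rewrite {1 2}eX subrr dot0l !dotE; move/dist_eq1: PQ; rewrite !dotE; lra.
have [d d0 apex] := apex_near nPQ PX QX nXM e0.
have [|S1] := ap (Num.min d e); first by rewrite lt_min d0.
case: S1 => [|P1 [|Q1 S1]] //=; rewrite ?andbF // !lt_min.
case/and3P => /andP [P1d P1e] /andP [Q1d Q1e] SS1 dom.
have [X2 [X2e PX2 QX2]] := apex _ _ P1d Q1d.
exists [:: P1, X2, Q1 & S1] => /=; last exact: domed_insert.
by rewrite P1e Q1e X2e (close_le _ SS1) // ge_min lexx orbT.
Qed.

(* [u] and [v] can be turned about their sum until [u] makes the angle 2 pi / 3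
   with [w]; the inequality says that the required value of [dot u w] lies
   between the extreme ones. *)
Definition rotatable (u v w : point) : Prop :=
  - 1 < dot u v /\
  (1 + dot (u + v) w) ^+ 2 * (1 + dot u v) <=
  (1 - dot u v) * (2 * (1 + dot u v) - dot (u + v) w ^+ 2).

(** [s] stays fixed while [a] turns in the plane normal to [s], where [w] projects to [z] of squared
    length [om]. As [dot s w] is [q / 2], the turned [a'] must satisfy [dot a' w = t]; the
    inequality of [rotatable] is [t ^+ 2 <= om * dot a a] with denominators cleared. *)
Lemma rotatable_rotation u v w :
  dot u u = 1 -> dot v v = 1 -> dot w w = 1 -> rotatable u v w ->
  exists u' v', [/\ dot u' u' = 1, dot v' v' = 1, u' + v' = u + v
                  & dot u' w = - 2^-1].
Proof.
move=> uu vv ww []; pose x := dot u v; pose q := dot (u + v) w.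
rewrite -/x -/q => x1 cond.
pose s := 2^-1 *: (u + v); pose a := 2^-1 *: (u - v).
have ss : dot s s = (1 + x) / 2 by rewrite /s !dotE (dotC v u) uu vv -/x; lra.
have aa : dot a a = (1 - x) / 2 by rewrite /a !dotE (dotC v u) uu vv -/x; lra.
have sa : dot s a = 0 by rewrite /s /a !dotE (dotC v u) uu vv; lra.
have sw : dot s w = q / 2 by rewrite /s dotZl mulrC.
have us : u = s + a by rewrite /s /a; vec.
have uv : u + v = s + s by rewrite /s; vec.
clearbody s a.
have ss0 : 0 < dot s s by rewrite ss; lra.
pose om := 1 - q ^+ 2 / (2 * (1 + x)).
pose z := w - (q / (1 + x)) *: s.
have zs : dot s z = 0 by rewrite /z !dotE sw ss; field; lra.
have zw : dot z w = om.
  by rewrite /z /om !dotE sw ww; field; lra.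
have wz : w = z + (q / (1 + x)) *: s by rewrite /z; vec.
have zz : dot z z = om.
  by rewrite -zw [in RHS]wz dotDr dotZr (dotC z s) zs mulr0 addr0.
clearbody z.
have omE : om * (2 * (1 + x)) = 2 * (1 + x) - q ^+ 2 by rewrite /om; field; lra.
(* If [om = 0], then [w] is parallel to [u + v], turning does not change [dot u w], and the
   inequality forces this value to be right already. *)
have [om0|om0] := eqVneq om 0.
  exists u, v; split=> //.
  have q1 : q = -1.
    have : (1 + q) ^+ 2 * (1 + x) <= 0 by rewrite om0 mul0r in omE; rewrite -omE mulr0 in cond.
    rewrite pmulr_lle0; last lra.
    by move=> h; have := sqr_ge0 (1 + q); nra.
  have z0 : z = 0 by apply/eqP; rewrite -dot_eq0 zz om0.
  rewrite us dotDl sw q1 [in dot a w]wz z0 add0r dotZr (dotC a) sa; lra.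
have om1 : 0 < om by rewrite lt_neqAle eq_sym om0 -zz dot_ge0.
pose t := - (1 + q) / 2.
have [b [bb bs bz]] := exists_unit_orthogonal s z.
have disc : 0 <= (1 - x) / 2 - t ^+ 2 / om.
  rewrite subr_ge0 ler_pdivrMr // -(ler_pM2r (_ : 0 < 4 * (1 + x))); last lra.
  have -> : (1 - x) / 2 * om * (4 * (1 + x)) = (1 - x) * (om * (2 * (1 + x))) by field.
  by rewrite omE; apply: le_trans cond; rewrite le_eqVlt /t; apply/orP; left; apply/eqP; field.
pose be := Num.sqrt ((1 - x) / 2 - t ^+ 2 / om).
have be2 : be ^+ 2 = (1 - x) / 2 - t ^+ 2 / om by rewrite sqr_sqrtr.
pose a' := (t / om) *: z + be *: b.
have a'a' : dot a' a' = (1 - x) / 2.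
  rewrite /a' !dotE (dotC z b) bz bb zz.
  transitivity (t ^+ 2 / om + be ^+ 2); first by field.
  by rewrite be2; ring.
have sa' : dot s a' = 0 by rewrite /a' !dotE zs (dotC s b) bs; ring.
have a'w : dot a' w = t.
  by rewrite /a' !dotE zw [in dot b w]wz !dotE bz bs !mulr0 addr0 mulr0 addr0 divfK.
clearbody a'.
exists (s + a'), (s - a'); split.
- by rewrite !dotE (dotC a' s) sa' a'a' ss; lra.
- by rewrite !dotE (dotC a' s) sa' a'a' ss; lra.
- by rewrite uv; vec.
- by rewrite dotDl sw a'w /t; lra.
Qed.

(** This Gram determinant is the defect in the Cauchy-Schwarz inequality for the components of [u]
    and [v] orthogonal to [w]. *)
Lemma gram3_ge0 u v w : dot u u = 1 -> dot v v = 1 -> dot w w = 1 ->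
  0 <= 1 + 2 * dot u v * dot v w * dot u w
       - dot u v ^+ 2 - dot v w ^+ 2 - dot u w ^+ 2.
Proof.
move=> uu vv ww.
have := dot_CauchySchwarz (u - dot u w *: w) (v - dot v w *: w).
rewrite !dotE (dotC w u) (dotC w v) uu vv ww.
set x := dot u v; set y := dot v w; set z := dot u w => h.
by rewrite -subr_ge0 in h; apply: le_trans h _; rewrite le_eqVlt; apply/orP; left; apply/eqP; ring.
Qed.

(** A half-turn about [u + v] takes [u] to [v], so the value -1/2 is met on the way. In algebra, the
    slack of the inequality is twice the Gram determinant plus
    [- (1 + 2 * y) * (1 + 2 * z) * (1 + x)]. *)
Lemma rotatable_interval u v w :
  dot u u = 1 -> dot v v = 1 -> dot w w = 1 -> - 1 < dot u v ->
  dot u w <= - 2^-1 -> - 2^-1 <= dot v w -> rotatable u v w.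
Proof.
move=> uu vv ww uv uw vw; split=> //; have := gram3_ge0 uu vv ww.
rewrite dotDl; set x := dot u v; set y := dot v w; set z := dot u w => gram.
have x1 : 0 <= 1 + x by rewrite /x; lra.
have h1 : 0 <= - ((1 + 2 * y) * (1 + 2 * z)) by rewrite /y /z; nra.
have h2 := mulr_ge0 h1 x1.
rewrite -subr_ge0; apply: le_trans (addr_ge0 h2 (addr_ge0 gram gram)) _.
by rewrite le_eqVlt; apply/orP; left; apply/eqP; ring.
Qed.

Lemma rotatable_obtuse u v w :
  - 2^-1 <= dot u v <= 0 -> - 1 <= dot (u + v) w <= 0 -> rotatable u v w.
Proof.
rewrite /rotatable; set x := dot u v; set q := dot (u + v) w.
move=> /andP [x1 x2] /andP [q1 q2]; split; first lra.
(* The slack of the inequality is [1 + 2 * x] plus twice the sum of these three products. *)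
have h1 : 0 <= - x * (x + 2^-1) by apply: mulr_ge0; lra.
have h2 : 0 <= - q * (1 + q) by apply: mulr_ge0; lra.
have h3 : 0 <= (1 + q) * - x by apply: mulr_ge0; lra.
lra.
Qed.

(** * Three edge vectors of a closed curve that admit the rotation *)

Lemma sum_lt0_exists (A : eqType) (E : seq A) (F : A -> R) :
  \sum_(e <- E) F e < 0 -> exists2 e, e \in E & F e < 0.
Proof.
move=> lt; apply/hasP; apply: contraTT lt => /hasPn h; rewrite -leNgt big_seq.
by apply: sumr_ge0 => e /h; rewrite -leNgt.
Qed.

Lemma dot_suml (E : seq point) w : dot (\sum_(e <- E) e) w = \sum_(e <- E) dot e w.
Proof. by elim: E => [|e E IH]; rewrite ?big_nil ?dot0l // !big_cons dotDl IH. Qed.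

Lemma unit_dot_gtN1 u v : dot u u = 1 -> dot v v = 1 -> v != - u -> -1 < dot u v.
Proof.
move=> uu vv; rewrite -subr_eq0 opprK -dot_gt0 !dotE (dotC v u) uu vv; lra.
Qed.

Lemma perm_swap2 (A : eqType) (a b : A) E : perm_eq [:: a, b & E] [:: b, a & E].
Proof. by have /permPl := perm_catCA [:: a] [:: b] E. Qed.

Lemma perm_rot3 (A : eqType) (a b c : A) E :
  perm_eq [:: a, b, c & E] [:: b, c, a & E].
Proof. by have /permPl := perm_catCA [:: a] [:: b; c] E. Qed.

Lemma exists_rotatable (E : seq point) :
  (3 < size E)%nat -> {in E, forall e, dot e e = 1} -> \sum_(e <- E) e = 0 ->
  {in E, forall u, exists t, [/\ t \in E, t != u & t != - u]} ->
  exists u v w E', perm_eq E [:: u, v, w & E'] /\ rotatable u v w.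
Proof.
move=> sz un sum0 ncol.
have sub3 u v w E' : perm_eq E [:: u, v, w & E'] ->
    [/\ dot u u = 1, dot v v = 1 & dot w w = 1].
  by move/perm_mem => pm; split; apply: un; rewrite pm !inE eqxx ?orbT.
have pick2 u v : u \in E -> v \in rem u E -> exists E', perm_eq E [:: u, v & E'].
  move=> uE vE; exists (rem v (rem u E)).
  by rewrite (perm_trans (perm_to_rem uE)) // perm_cons perm_to_rem.
have pick3 u v w E' : perm_eq E [:: u, v & E'] -> w \in E' ->
    exists E'', perm_eq E [:: u, v, w & E''].
  move=> pm wE; exists (rem w E').
  by rewrite (perm_trans pm) // !perm_cons perm_to_rem.
have sumE u v E' w : perm_eq E [:: u, v & E'] ->
    dot u w + (dot v w + \sum_(e <- E') dot e w) = 0.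
  move=> pm; have := dot_suml E w.
  by rewrite sum0 dot0l (perm_big _ pm) !big_cons.
(* An opposite pair: whichever of [u], [- u] serves as the third vector, the other has product -1
   with it, and a transversal edge [t] has product at least -1/2 with one of them. *)
have [/hasP [u uE Nu]|/hasPn noanti] := boolP (has (fun u => - u \in rem u E) E).
  have [E2 pm] := pick2 _ _ uE Nu; have [t [tE tu tNu]] := ncol u uE.
  have : t \in E2 by move: tE; rewrite (perm_mem pm) !inE (negPf tu) (negPf tNu).
  case/(pick3 _ _ _ _ pm) => E3 pm3; have [uu NuNu tt] := sub3 _ _ _ _ pm3.
  have tu1 := unit_dot_gtN1 uu tt tNu.
  have tu2 : -1 < dot (- u) t by apply: unit_dot_gtN1; rewrite // opprK.
  have [le|lt] := leP (- 2^-1) (dot t (- u)).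
    exists u, t, (- u), E3; split; last by apply: rotatable_interval; rewrite // dotNr uu; lra.
    by rewrite (perm_trans pm3) // perm_cons perm_swap2.
  exists (- u), t, u, E3; split.
    by rewrite (perm_trans pm3) // perm_rot3.
  apply: rotatable_interval; rewrite // ?dotNl ?uu; move: lt; rewrite ?dotNr; lra.
have pairN u v E' : perm_eq E [:: u, v & E'] -> v != - u.
  move=> pm; have uE : u \in E by rewrite (perm_mem pm) inE eqxx.
  have := perm_to_rem uE; rewrite perm_sym => /perm_trans /(_ pm).
  rewrite perm_cons => /perm_mem pm2; have := noanti u uE; rewrite pm2.
  by apply: contraNneq => <-; rewrite inE eqxx.
(* A pair with product at most -1/2: the products with [w] sum to zero over all edges, so the
   remaining edges, at least two, cannot all have product at most -1/2 with [w]. *)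
have [/hasP [w wE /hasP [u uE wu]]|/hasPn big] :=
  boolP (has (fun w => has (fun u => dot u w <= - 2^-1) (rem w E)) E).
  have [E2 pm] := pick2 _ _ wE uE; have sm := sumE _ _ _ w pm.
  have szE2 : (2 <= size E2)%nat by move: sz; rewrite (perm_size pm).
  have [|v vE lt] := @sum_lt0_exists _ E2 (fun e => - (dot e w + 2^-1)).
    rewrite sumrN big_split /= big_const_seq count_predT iter_addr_0 oppr_lt0.
    rewrite un // in sm.
    have : 2 <= (size E2)%:R :> R by rewrite ler_nat.
    by rewrite -[2^-1 *+ _]mulr_natr; lra.
  have [E3 pm3] := pick3 _ _ _ _ pm vE; have [ww uu vv] := sub3 _ _ _ _ pm3.
  have pm4 : perm_eq E [:: u, v, w & E3].
    by rewrite (perm_trans pm3) // perm_rot3.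
  exists u, v, w, E3; split=> //; apply: rotatable_interval => //; last lra.
  by apply: unit_dot_gtN1 => //; apply: pairN pm4.
have bigE u v E' : perm_eq E [:: u, v & E'] -> - 2^-1 < dot u v.
  move=> pm; have uE : u \in E by rewrite (perm_mem pm) inE eqxx.
  have := perm_to_rem uE; rewrite perm_sym => /perm_trans /(_ pm).
  rewrite perm_cons => /perm_mem pm2; have /hasPn := big u uE.
  by move=> /(_ v); rewrite pm2 inE eqxx -ltNge dotC => /(_ erefl).
(* Now all products exceed -1/2. As the edges sum to zero, some [dot u v] is negative and then some
   [dot (u + v) w] is; the latter stays above -1. *)
have [u uE] : exists u, u \in E.
  by case: (E) sz => // u E1 _; exists u; rewrite inE eqxx.
have [|v vE uv0] := @sum_lt0_exists _ (rem u E) (fun e => dot e u).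
  have := dot_suml E u; rewrite sum0 dot0l (perm_big _ (perm_to_rem uE)) big_cons.
  by rewrite (un u) //= => sm; lra.
have [E2 pm] := pick2 _ _ uE vE; have uv1 := bigE _ _ _ pm; rewrite dotC in uv0.
have vE' : v \in E by rewrite (perm_mem pm) !inE eqxx orbT.
have [|w wE q0] := @sum_lt0_exists _ E2 (fun e => dot e (u + v)).
  by have := sumE _ _ _ (u + v) pm; rewrite !dotDr (dotC v u) !un //; lra.
have [E3 pm3] := pick3 _ _ _ _ pm wE.
exists u, v, w, E3; split=> //; rewrite dotC in q0.
have uw1 : - 2^-1 < dot u w.
  apply: (bigE u w (v :: E3)); by rewrite (perm_trans pm3) // perm_cons perm_swap2.
have vw1 : - 2^-1 < dot v w.
  apply: (bigE v w (u :: E3)); by rewrite (perm_trans pm3) // perm_rot3.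
apply: rotatable_obtuse; first lra.
by rewrite (ltW q0) dotDl andbT; lra.
Qed.

(** * Closed sequences of unit vectors *)

(** The end of the last edge is left out; for vectors with sum zero it is [v] again. *)
Fixpoint curve (v : point) (E : seq point) : seq point :=
  if E is e :: E' then v :: curve (v + e) E' else [::].

(** A cyclic shift of the edges changes the starting vertex, hence the quantification over [v]. *)
Definition edges_approximable (E : seq point) : Prop :=
  forall v, approximable (curve v E).

Lemma curve_cat v E1 E2 :
  curve v (E1 ++ E2) = curve v E1 ++ curve (v + \sum_(e <- E1) e) E2.
Proof.
elim: E1 v => [|e E1 IH] v /=; first by rewrite big_nil addr0.
by rewrite IH big_cons addrA.
Qed.

Lemma edges_approximable_catC E1 E2 : \sum_(e <- E1 ++ E2) e = 0 ->
  edges_approximable (E1 ++ E2) -> edges_approximable (E2 ++ E1).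
Proof.
rewrite big_cat /= => sum0 ap v.
have := ap (v + \sum_(e <- E2) e); rewrite !curve_cat.
have -> : v + \sum_(e <- E2) e + \sum_(e <- E1) e = v.
  by rewrite addrAC -addrA sum0 addr0.
move=> /(approximable_rot (size (curve (v + \sum_(e <- E2) e) E1))).
by rewrite rot_size_cat.
Qed.

Lemma edges_approximable_swap E1 e f E2 :
  (2 < size (E1 ++ [:: e, f & E2]))%nat -> \sum_(x <- E1 ++ [:: e, f & E2]) x = 0 ->
  edges_approximable (E1 ++ [:: e, f & E2]) ->
  edges_approximable (E1 ++ [:: f, e & E2]).
Proof.
move=> sz sum0 /(edges_approximable_catC sum0) ap.
apply: (@edges_approximable_catC [:: f, e & E2]).
  by rewrite -[RHS]sum0; apply: perm_big; rewrite perm_catC perm_cat2l perm_swap2.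
(* A third edge [g] is needed for [v + e + f] to be a listed vertex. *)
have : (0 < size (E2 ++ E1))%nat.
  by move: sz; rewrite !size_cat /= addnC !addSn !ltnS.
move: ap; rewrite !cat_cons; case: (E2 ++ E1) => // g E3 ap _ v.
have /= := ap v => /approximable_swap.
have -> : v + (v + e + f) - (v + e) = v + f by vec.
by have -> : v + e + f = v + f + e by rewrite addrAC.
Qed.

Lemma edges_approximable_move E1 e E2 E3 :
  (2 < size (E1 ++ e :: E2 ++ E3))%nat -> \sum_(x <- E1 ++ e :: E2 ++ E3) x = 0 ->
  edges_approximable (E1 ++ e :: E2 ++ E3) ->
  edges_approximable (E1 ++ E2 ++ e :: E3).
Proof.
elim: E2 E1 => [|f E2 IH] E1 //= sz sum0 ap.
rewrite -cat_rcons; apply: IH; rewrite cat_rcons.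
- by move: sz; rewrite !size_cat /=.
- by rewrite -[RHS]sum0; apply: perm_big; rewrite perm_cat2l perm_swap2.
- exact: edges_approximable_swap.
Qed.

Lemma edges_approximable_perm E E' : (2 < size E)%nat -> \sum_(x <- E) x = 0 ->
  perm_eq E E' -> edges_approximable E -> edges_approximable E'.
Proof.
move=> sz sum0 pm; rewrite -[E]cat0s -[E']cat0s in sz sum0 *.
elim: E E' [::] pm sz sum0 => [|a A IH] B E1 pm sz sum0.
  by rewrite perm_sym in pm; rewrite (perm_nilP pm).
have aB : a \in B by rewrite -(perm_mem pm) inE eqxx.
case/splitPr: aB pm => B1 B2 pm.
have pm2 : perm_eq A (B1 ++ B2).
  by rewrite -(perm_cons a) (perm_trans pm) // -cat1s perm_catCA.
have pm3 : perm_eq (E1 ++ a :: A) (E1 ++ a :: B1 ++ B2).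
  by rewrite perm_cat2l perm_cons.
move=> ap; apply: edges_approximable_move.
- by rewrite -(perm_size pm3).
- by rewrite -[RHS]sum0; apply: perm_big; rewrite perm_sym.
- by rewrite -cat_rcons; apply: (IH _ _ pm2); rewrite cat_rcons.
Qed.

Lemma edges_approximable_rotate e f e' f' g E :
  dot e e = 1 -> dot f f = 1 -> dot e' e' = 1 -> dot f' f' = 1 ->
  e' + f' = e + f -> e + f != 0 ->
  edges_approximable [:: e, f, g & E] -> edges_approximable [:: e', f', g & E].
Proof.
move=> ee ff ee' ff' ef nef ap v.
have /= := ap v; have -> : v + e' + f' = v + e + f by rewrite -!addrA ef.
have distD p x : dot x x = 1 -> dist p (p + x) = 1.
  by move=> xx; apply/dist_eq1; rewrite (_ : p - (p + x) = - x) ?dotNl ?dotNr ?opprK //; vec.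
apply: approximable_rotate.
- by apply: contra_neq nef => h; apply: (addrI v); rewrite addr0 addrA -h.
- exact: distD.
- by rewrite distC; apply: distD.
- exact: distD.
- have -> : v + e + f = v + e' + f' by rewrite -!addrA ef.
  by rewrite distC; apply: distD.
Qed.

Lemma edges_approximable_split e f g E :
  dot e e = 1 -> dot f f = 1 -> dot (e + f) (e + f) = 1 ->
  edges_approximable [:: e + f, g & E] -> edges_approximable [:: e, f, g & E].
Proof.
move=> ee ff ef ap v; have /= := ap v; rewrite addrA.
apply: approximable_insert; apply/dist_eq1.
- by rewrite (_ : _ - _ = - (e + f)) ?dotNl ?dotNr ?opprK //; vec.
- by rewrite (_ : _ - _ = - e) ?dotNl ?dotNr ?opprK //; vec.
- by rewrite (_ : _ - _ = f) //; vec.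
Qed.

Lemma unit_perturb u eps : dot u u = 1 -> 0 < eps ->
  exists u', [/\ dot u' u' = 1, u' != u, u' != - u & dist u u' < eps].
Proof.
move=> uu e0; have [w [ww wu _]] := exists_unit_orthogonal u u.
(* With the cosine [c] between 0 and 1, the squared distance [2 * (1 - c)] is at most [2 * s ^+ 2],
   hence below [eps ^+ 2]. *)
pose s := Num.min (eps / 2) 2^-1.
have s0 : 0 < s by rewrite /s lt_min divr_gt0 //=; lra.
have [s1 s2] : s <= eps / 2 /\ s <= 2^-1 by split; rewrite /s ge_min lexx ?orbT.
pose c := Num.sqrt (1 - s ^+ 2).
have c2 : c ^+ 2 = 1 - s ^+ 2 by rewrite sqr_sqrtr //; nra.
have c0 : 0 <= c := sqrtr_ge0 _.
pose u' := c *: u + s *: w.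
have uw : dot u' w = s by rewrite /u' !dotE (dotC u) wu ww; ring.
have uw0 : dot u w = 0 by rewrite dotC.
exists u'; split.
- rewrite /u' !dotE (dotC u w) wu ww uu.
  transitivity (c ^+ 2 + s ^+ 2); first by ring.
  by rewrite c2 subrK.
- by apply/eqP => eu; move: uw; rewrite eu uw0; lra.
- by apply/eqP => eu; move: uw; rewrite eu dotNl uw0; lra.
- rewrite dist_norm -(ltr_pXn2r (_ : 0 < 2)%nat) ?nnegrE ?norm_ge0 ?(ltW e0) // norm_sqr.
  rewrite (_ : u - u' = (1 - c) *: u - s *: w); last by rewrite /u'; vec.
  rewrite !dotE (dotC w u) uw0 ww uu; nra.
Qed.

Lemma edges_approximable_closed E : (2 < size E)%nat ->
  {in E, forall e, dot e e = 1} -> \sum_(e <- E) e = 0 -> edges_approximable E.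
Proof.
move: {2}(size E - 3)%nat (erefl (size E - 3)%nat) => n eqn.
elim: n E eqn => [|n IH] E eqn sz un sum0.
  case: E eqn sz un sum0 => [|e1 [|e2 [|e3 [|//]]]] // _ _ un sum0 v.
  apply: domed_approximable.
  have [u1 u2 u3] : [/\ dot e1 e1 = 1, dot e2 e2 = 1 & dot e3 e3 = 1].
    by split; apply: un; rewrite !inE eqxx ?orbT.
  move: sum0; rewrite !big_cons big_nil addr0 => sum0.
  have e3E : e3 = - (e1 + e2).
    by apply/eqP; rewrite -subr_eq0 opprK addrC -addrA sum0.
  apply: domed_triangle; apply/dist_eq1.
  - by rewrite (_ : _ - _ = - e1) ?dotNl ?dotNr ?opprK //; vec.
  - by rewrite (_ : _ - _ = - e2) ?dotNl ?dotNr ?opprK //; vec.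
  - by rewrite (_ : _ - _ = - e3) ?dotNl ?dotNr ?opprK // e3E; vec.
have generic F : size F = size E -> {in F, forall e, dot e e = 1} ->
    \sum_(e <- F) e = 0 ->
    {in F, forall u, exists t, [/\ t \in F, t != u & t != - u]} ->
    edges_approximable F.
  move=> szF unF sumF ncol.
  have sz4 : (3 < size F)%nat by rewrite szF -subn_gt0 eqn.
  have [u [v [w [F' [pm rot]]]]] := exists_rotatable sz4 unF sumF ncol.
  have [uu vv ww] : [/\ dot u u = 1, dot v v = 1 & dot w w = 1].
    by split; apply: unF; rewrite (perm_mem pm) !inE eqxx ?orbT.
  have unF' e : e \in F' -> dot e e = 1.
    by move=> eF; apply: unF; rewrite (perm_mem pm) !inE eF !orbT.
  have [u' [v' [uu' vv' uv' uw']]] := rotatable_rotation uu vv ww rot.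
  have sumF' : u' + (v' + (w + \sum_(e <- F') e)) = 0.
    by rewrite addrA uv' -addrA -!(big_cons _ _ _ _ xpredT id) -(perm_big _ pm).
  have szF' : size F = (size F').+3 by rewrite (perm_size pm).
  have uw1 : dot (u' + w) (u' + w) = 1.
    by rewrite !dotE (dotC w) uu' ww uw'; lra.
  have F'0 : (0 < size F')%nat by move: sz4; rewrite szF'.
  have sum1 : \sum_(e <- [:: u', w, v' & F']) e = 0.
    by rewrite !big_cons [w + _]addrCA.
  have sum2 : \sum_(e <- [:: u, v, w & F']) e = 0 by rewrite -(perm_big _ pm).
  (* The induction hypothesis covers the shortened curve. From there the edge [u' + w] is split, [w]
     and [v'] are exchanged, and [u'], [v'] are turned back to [u], [v]. *)
  have : edges_approximable [:: u' + w, v' & F'].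
    apply: IH => //.
    - by move: eqn; rewrite -szF szF' /= !subSS subn0 => ->; rewrite subn1.
    - move=> e; rewrite !inE => /orP [/eqP ->|/orP [/eqP ->|/unF']] //.
    - by rewrite -[RHS]sum1 !big_cons -addrA.
  move=> /(edges_approximable_split uu' ww uw1) ap1.
  have pm1 : perm_eq [:: u', w, v' & F'] [:: u', v', w & F'] by rewrite perm_cons perm_swap2.
  have ap2 := edges_approximable_perm (erefl : (2 < size [:: u', w, v' & F'])%nat) sum1 pm1 ap1.
  have nuv : u' + v' != 0.
    rewrite uv' -dot_gt0 !dotE (dotC v) uu vv; case: rot; lra.
  have ap3 := edges_approximable_rotate uu' vv' uu vv (esym uv') nuv ap2.
  by apply: edges_approximable_perm ap3; rewrite // perm_sym.
have [/allP ncol|] := boolP (all (fun u => has (fun t => (t != u) && (t != - u)) E) E).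
  apply: generic => // u /ncol /hasP [t tE /andP [h1 h2]]; by exists t.
case/allPn => u uE /hasPn col.
have {}col t : t \in E -> t = u \/ t = - u.
  by move/col; rewrite negb_and !negbK => /orP [] /eqP ->; [left|right].
have uu := un u uE.
have [t tE tu] : exists2 t, t \in rem u E & dot t u < 0.
  apply: sum_lt0_exists.
  have := dot_suml E u; rewrite sum0 dot0l (perm_big _ (perm_to_rem uE)) big_cons /= uu.
  by move=> sm; lra.
have tE' : t = - u.
  by case: (col t (mem_rem tE)) => // tu'; exfalso; move: tu; rewrite tu' uu; lra.
have pm : perm_eq E [:: u, - u & rem t (rem u E)].
  by rewrite (perm_trans (perm_to_rem uE)) // perm_cons -tE' perm_to_rem.
set E2 := rem t (rem u E) in pm.
have E2E e : e \in E2 -> e \in E by move=> eE; rewrite (perm_mem pm) !inE eE !orbT.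
have szE : size E = (size E2).+2 by rewrite (perm_size pm).
have sumE2 : \sum_(e <- E2) e = 0.
  by rewrite -[RHS]sum0 (perm_big _ pm) !big_cons /= addrA subrr add0r.
(* With at least four edges, another edge [x] parallel to [u] is left; after the perturbation, [x]
   and [u'] witness that the edges are not all parallel. *)
have [x xE2] : exists x, x \in E2.
  move: eqn; rewrite szE; case: (E2) => [|x l] //; by exists x; rewrite inE eqxx.
suff : edges_approximable [:: u, - u & E2].
  apply: edges_approximable_perm; rewrite ?[size _]/= -?szE // 1?perm_sym //.
  by rewrite -(perm_big _ pm).
move=> v; apply: approximable_limit => e e0.
have [u' [uu' nu nNu near_]] := unit_perturb uu e0.
(* As [u'] and [- u'] cancel, only the vertex [v + u] moves. *)
exists (curve v [:: u', - u' & E2]).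
  rewrite /= distpp e0 !addrK /=; apply/andP; split; last exact: close_refl.
  by rewrite dist_norm opprD addrACA subrr add0r -dist_norm.
have u'N : - u' != u by rewrite -subr_eq0 -opprD oppr_eq0 addr_eq0.
have u'NN : - u' != - u by rewrite -subr_eq0 -opprD oppr_eq0 subr_eq0.
apply: generic.
- by rewrite szE.
- move=> y; rewrite !inE => /orP [/eqP ->|/orP [/eqP ->|/E2E/un]] //.
  by rewrite dotNl dotNr opprK.
- by rewrite !big_cons sumE2 addr0 subrr.
- have in1 : u' \in [:: u', - u' & E2] by rewrite inE eqxx.
  have inx : x \in [:: u', - u' & E2] by rewrite !inE xE2 !orbT.
  have xu : x = u \/ x = - u by apply/col/E2E.
  move=> y; rewrite !inE => /orP [/eqP ->|/orP [/eqP ->|/E2E/col]].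
  + by exists x; split=> //; case: xu => ->; rewrite eq_sym ?opprK // ?eqr_opp // eqr_oppLR.
  + by exists x; split=> //; case: xu => ->; rewrite eq_sym ?opprK // ?eqr_opp // eqr_oppLR.
  + by case=> ->; exists u'; split; rewrite ?opprK.
Qed.

Definition differences (S : seq point) : seq point :=
  [seq p.2 - p.1 | p <- cyclic_pairs S].

Lemma curve_differences v l z :
  curve v [seq p.2 - p.1 | p <- zip (v :: l) (rcons l z)] = v :: l.
Proof.
elim: l v => [|x l IH] v //=; congr (_ :: _).
by rewrite -[RHS]IH addrC subrK.
Qed.

Lemma sum_differences (v : point) l z :
  \sum_(e <- [seq p.2 - p.1 | p <- zip (v :: l) (rcons l z)]) e = z - v.
Proof.
elim: l v => [|x l IH] v /=; first by rewrite big_cons big_nil addr0.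
by rewrite big_cons IH addrC addrA subrK.
Qed.

Theorem theorem1p2 (n : nat) (g : 'I_n -> point) :
  (3 <= n)%nat -> integral_curve g ->
  forall eps : R, 0 < eps ->
  exists g' : 'I_n -> point,
    [/\ integral_curve g', frechet g g' < eps & can_be_domed g'].
Proof.
move=> n3 ig eps e0.
pose S := map g (enum 'I_n).
have szS : size S = n by rewrite size_map size_enum_ord.
have nthS (i : 'I_n) : nth 0 S i = g i.
  by rewrite (nth_map i) ?size_enum_ord // nth_ord_enum.
have unit_diff : {in differences S, forall e, dot e e = 1}.
  move=> e /mapP [[p q] /(cyclic_pairsP 0 _ _ szS) [i [-> ->]] ->].
  rewrite [_.1]/= [_.2]/= (nthS i) (nthS (ordS i)); apply/dist_eq1.
  by rewrite distC; apply: ig.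
have : approximable S.
  case: (S) szS unit_diff => [|v l] szS un; first by move: n3; rewrite -szS.
  rewrite -(curve_differences v l v); apply: edges_approximable_closed => //.
  - by rewrite size_map size_zip size_rcons minnn; rewrite -szS in n3.
  - by move=> e eD; apply: un; rewrite /differences /cyclic_pairs rot1_cons.
  - by rewrite sum_differences subrr.
case/(_ eps e0) => S' SS' dS'.
have szS' : size S' = n.
  by move: SS'; rewrite /close all2E szS => /andP [/eqP].
exists (fun i => nth 0 S' i); split.
- move=> i; apply: (domed_pair_dist dS').
  by apply/(cyclic_pairsP 0 _ _ szS'); exists i.
- rewrite /frechet; apply: bigmax_lt => // i _.
  move: SS'; rewrite /close all2E => /andP [_ /all_nthP h].
  have := h (0, 0) i; rewrite size_zip szS szS' minnn ltn_ord => /(_ erefl).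
  by rewrite nth_zip ?szS ?szS' //= nthS.
- exact: domed_can_be_domed.
Qed.
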